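(* There is an absolute constant $c>0$ such that for every $n\ge 3$ and every $3$-uniform hypergraph $H$ on $n$ vertices with at least one hyperedge, $Q(f_H) \ge c\, n^{4/5}$.
   Context: For a fixed $3$-uniform hypergraph $H$ on vertex set $[n]$, $f_H:\{0,1\}^{\binom{n}{3}}\to\{0,1\}$ takes as input a $3$-uniform hypergraph $G$ on $[n]$, given by the $\binom n3$ hyperedge-indicator bits (one per $3$-element subset of $[n]$), and $f_H(G)=1$ iff $H$ is isomorphic to a (not necessarily induced) subhypergraph of $G$, i.e. there is a bijection $\pi:[n]\to[n]$ mapping every hyperedge of $H$ to a hyperedge of $G$. $Q(f)$ denotes the bounded-error (success probability at least $2/3$) quantum query complexity of a Boolean function $f$. *)

(* Defs.v *)
From Stdlib Require Import Reals Lra Lia Arith List.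
Import ListNotations.
Open Scope R_scope.

Record Cx := mkCx { re : R; im : R }.
Definition C0 : Cx := mkCx 0 0.
Definition C1 : Cx := mkCx 1 0.
Definition Cadd (x y : Cx) : Cx := mkCx (re x + re y) (im x + im y).
Definition Cmul (x y : Cx) : Cx :=
  mkCx (re x * re y - im x * im y) (re x * im y + im x * re y).
Definition Cconj (x : Cx) : Cx := mkCx (re x) (- im x).
Definition Cscale (r : R) (x : Cx) : Cx := mkCx (r * re x) (r * im x).
Definition Cnorm2 (x : Cx) : R := re x * re x + im x * im x.

Definition Csum (d : nat) (f : nat -> Cx) : Cx := fold_right Cadd C0 (map f (seq 0 d)).
Definition Rsum (d : nat) (f : nat -> R) : R := fold_right Rplus 0 (map f (seq 0 d)).

(** * Linear algebra on C^d: vectors nat -> Cx, matrices nat -> nat -> Cx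
    (only entries with indices < d are meaningful). *)
Definition apply (d : nat) (M : nat -> nat -> Cx) (v : nat -> Cx) : nat -> Cx :=
  fun k => Csum d (fun j => Cmul (M k j) (v j)).

(** M is a unitary d x d matrix: M^* M = I (equivalent to unitarity in finite dim). *)
Definition unitary (d : nat) (M : nat -> nat -> Cx) : Prop :=
  forall i j, (i < d)%nat -> (j < d)%nat ->
    Csum d (fun k => Cmul (Cconj (M k i)) (M k j)) = if Nat.eqb i j then C1 else C0.

Definition e0 : nat -> Cx := fun k => if Nat.eqb k 0 then C1 else C0.

(** * 3-uniform hypergraphs on [n] = {0,...,n-1}.
    A hypergraph is given by its indicator G a b c, meaningful for a < b < c < n
    (one bit per 3-element subset {a,b,c}). *)
Definition hgraph := nat -> nat -> nat -> bool.

(** membership of the unordered triple {x,y,z} (x,y,z distinct) *)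
Definition min3 (x y z : nat) : nat := Nat.min x (Nat.min y z).
Definition max3 (x y z : nat) : nat := Nat.max x (Nat.max y z).
Definition mid3 (x y z : nat) : nat := (x + y + z - min3 x y z - max3 x y z)%nat.
Definition hasE (G : hgraph) (x y z : nat) : bool := G (min3 x y z) (mid3 x y z) (max3 x y z).

Definition contains (n : nat) (H G : hgraph) : Prop :=
  exists pi : nat -> nat,
    (forall i, (i < n)%nat -> (pi i < n)%nat) /\
    (forall i j, (i < n)%nat -> (j < n)%nat -> pi i = pi j -> i = j) /\
    (forall a b c, (a < b)%nat -> (b < c)%nat -> (c < n)%nat -> H a b c = true ->
        hasE G (pi a) (pi b) (pi c) = true).

(** * Quantum query algorithms (phase oracle model).
    Hilbert space C^(n^3 * m): basis index k <-> (query register q = k / m,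
    workspace w = k mod m), q < n^3 encodes (a,b,c) = (q/(n*n), (q/n) mod n, q mod n).
    The oracle O_G multiplies |q,w> by (-1)^{G a b c} if a < b < c, and by 1 otherwise
    (other values of q act as null queries). *)
Definition qdim (n m : nat) : nat := (n * n * n * m)%nat.

Definition phase (n m : nat) (G : hgraph) (k : nat) : R :=
  let q := (k / m)%nat in
  let a := (q / (n * n))%nat in
  let b := ((q / n) mod n)%nat in
  let c := (q mod n)%nat in
  if (Nat.ltb a b && Nat.ltb b c)%bool then (if G a b c then -1 else 1) else 1.

Definition oracle (n m : nat) (G : hgraph) (v : nat -> Cx) : nat -> Cx :=
  fun k => Cscale (phase n m G k) (v k).

Fixpoint qstate (n m : nat) (U : nat -> nat -> nat -> Cx) (G : hgraph) (t : nat)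
  : nat -> Cx :=
  match t with
  | O => apply (qdim n m) (U O) e0
  | S t' => apply (qdim n m) (U t) (oracle n m G (qstate n m U G t'))
  end.

Definition prob1 (n m : nat) (U : nat -> nat -> nat -> Cx) (out : nat -> bool)
  (G : hgraph) (T : nat) : R :=
  Rsum (qdim n m) (fun k => if out k then Cnorm2 (qstate n m U G T k) else 0).

Definition computes_fH (n : nat) (H : hgraph) (m T : nat)
  (U : nat -> nat -> nat -> Cx) (out : nat -> bool) : Prop :=
  (0 < m)%nat /\
  (forall t, (t <= T)%nat -> unitary (qdim n m) (U t)) /\
  (forall G : hgraph,
     (contains n H G -> prob1 n m U out G T >= 2/3) /\
     (~ contains n H G -> prob1 n m U out G T <= 1/3)).

(* Main.v *)
(** By the adversary method, [p * p' <= 1296 q q' T^2] whenever rejected and accepted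
    inputs are paired so that each input bit separates at most a [q / p] fraction of the
    pairs at any rejected input and at most a [q' / p'] fraction at any accepted one.

    Deleting single hyperedges from [H] gives [|E(H)| = O(T^2)].  If [tau] is the
    transversal number of [H], then [H] embeds into the hypergraph of all triples meeting
    a set [W] exactly when [|W| >= tau], so [tau (n - tau + 1) = O(T^2)].  When [tau] is
    linear in [n] the Turan bound [|E(H)| (n - tau + 1)^2 = Omega(n^3)] turns these two
    estimates into [n^5 = O(T^6)].

    When [tau] is small, the set of triples meeting a fixed set [A] of [tau - 1] vertices
    is rejected, and it becomes accepted when one full star is added.  One passes
    from a rejected to an accepted hypergraph by adding stars with few centres in a
    large set [X], whose links are graphs on a disjoint large set [Y].  Among the accepted
    hypergraphs obtained in this way choose one that is extremal for
    [sum_x (n+1)^(deg x)], with [k] centres and largest degree [s].  Moving one centre gives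
    [k n = O(T^2)]; lowering one largest link while raising many empty links to the same
    lower degree (still rejected, by extremality) gives [s n = O(T^2)]; a random
    copy of the whole configuration gives [n^3 / (k s) = O(T^2)].  The product of the three
    bounds is again [n^5 = O(T^6)], which is stronger than the claim. *)
From Stdlib Require Import Reals Lra Lia.
From HB Require Import structures.
From mathcomp Require all_boot all_fingroup zify.
Require Import Defs.

Lemma sort3_cases (x y z : nat) (a := min3 x y z) (b := mid3 x y z) (c := max3 x y z) :
  (a = x /\ b = y /\ c = z) \/ (a = x /\ b = z /\ c = y) \/
  (a = y /\ b = x /\ c = z) \/ (a = y /\ b = z /\ c = x) \/
  (a = z /\ b = x /\ c = y) \/ (a = z /\ b = y /\ c = x).
Proof.
subst a b c; unfold mid3, min3, max3.
destruct (Nat.le_ge_cases x y), (Nat.le_ge_cases y z), (Nat.le_ge_cases x z);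
  repeat (rewrite Nat.min_l by lia || rewrite Nat.min_r by lia ||
          rewrite Nat.max_l by lia || rewrite Nat.max_r by lia);
  first [ left; split; [|split]; lia | right; left; split; [|split]; lia
        | do 2 right; left; split; [|split]; lia | do 3 right; left; split; [|split]; lia
        | do 4 right; left; split; [|split]; lia | do 5 right; split; [|split]; lia ].
Qed.

Module QueryBounds.
Import all_boot all_fingroup zify.
Set Implicit Arguments.
Unset Strict Implicit.
Unset Printing Implicit Defensive.
Delimit Scope R_scope with R.
Local Open Scope nat_scope.

(** * The adversary method *)

Lemma RplusA : associative Rplus. Proof. by move=> x y z; rewrite Rplus_assoc. Qed.
HB.instance Definition _ := Monoid.isComLaw.Build R 0%R Rplus RplusA Rplus_comm Rplus_0_l.
HB.instance Definition _ := Monoid.isMulLaw.Build R 0%R Rmult Rmult_0_l Rmult_0_r.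
HB.instance Definition _ :=
  Monoid.isAddLaw.Build R Rmult Rplus Rmult_plus_distr_r Rmult_plus_distr_l.

Lemma Cx_eq (x y : Cx) : re x = re y -> im x = im y -> x = y.
Proof. by case: x => a b; case: y => c d /= -> ->. Qed.

Lemma CaddA : associative Cadd.
Proof. by move=> x y z; apply: Cx_eq; rewrite /= Rplus_assoc. Qed.
Lemma CaddC : commutative Cadd.
Proof. by move=> x y; apply: Cx_eq; rewrite /= Rplus_comm. Qed.
Lemma Cadd0x : left_id C0 Cadd.
Proof. by move=> x; apply: Cx_eq; rewrite /= Rplus_0_l. Qed.
Lemma CmulC : commutative Cmul.
Proof. by move=> x y; apply: Cx_eq => /=; ring. Qed.
Lemma Cmul0x : left_zero C0 Cmul.
Proof. by move=> x; apply: Cx_eq => /=; ring. Qed.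
Lemma Cmulx0 : right_zero C0 Cmul.
Proof. by move=> x; rewrite CmulC Cmul0x. Qed.
Lemma CmulDl : left_distributive Cmul Cadd.
Proof. by move=> x y z; apply: Cx_eq => /=; ring. Qed.
Lemma CmulDr : right_distributive Cmul Cadd.
Proof. by move=> x y z; apply: Cx_eq => /=; ring. Qed.
HB.instance Definition _ := Monoid.isComLaw.Build Cx C0 Cadd CaddA CaddC Cadd0x.
HB.instance Definition _ := Monoid.isMulLaw.Build Cx C0 Cmul Cmul0x Cmulx0.
HB.instance Definition _ := Monoid.isAddLaw.Build Cx Cmul Cadd CmulDl CmulDr.

Lemma fold_right_bigE (T : Type) (op : T -> T -> T) (idx : T) (d : nat) (f : nat -> T) :
  List.fold_right op idx (List.map f (List.seq 0 d)) = \big[op/idx]_(i < d) f i.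
Proof.
rewrite -(big_mkord xpredT) /index_iota subn0.
by elim: d 0 => [|d IH] s /=; rewrite ?big_nil // big_cons IH.
Qed.

Lemma CsumE d f : Csum d f = \big[Cadd/C0]_(i < d) f i.
Proof. exact: fold_right_bigE. Qed.

Lemma RsumE d f : Rsum d f = \big[Rplus/0%R]_(i < d) f i.
Proof. exact: fold_right_bigE. Qed.

Lemma re_sum (I : Type) (r : seq I) (P : pred I) (F : I -> Cx) :
  re (\big[Cadd/C0]_(i <- r | P i) F i) = \big[Rplus/0%R]_(i <- r | P i) re (F i).
Proof. by apply: big_morph. Qed.

Lemma Cconj_sum (I : Type) (r : seq I) (P : pred I) (F : I -> Cx) :
  Cconj (\big[Cadd/C0]_(i <- r | P i) F i) = \big[Cadd/C0]_(i <- r | P i) Cconj (F i).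
Proof.
apply: big_morph => [x y|]; apply: Cx_eq => /=; ring.
Qed.

Lemma Rsum_le (I : Type) (r : seq I) (P : pred I) (F G : I -> R) :
  (forall i, P i -> (F i <= G i)%R) ->
  (\big[Rplus/0%R]_(i <- r | P i) F i <= \big[Rplus/0%R]_(i <- r | P i) G i)%R.
Proof. by move=> le; apply: (big_ind2 Rle) => //; [lra | move=> *; lra]. Qed.

Lemma Rsum_const (I : finType) (A : pred I) (c : R) :
  \big[Rplus/0%R]_(i in A) c = (INR #|A| * c)%R.
Proof.
rewrite big_const; elim: #|A| => [|k IH]; first by rewrite /=; lra.
by rewrite [iter _ _ _]/= IH S_INR; lra.
Qed.

Definition ip d (v w : nat -> Cx) : Cx := \big[Cadd/C0]_(k < d) Cmul (Cconj (v k)) (w k).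

Lemma unitary_ip d M v w : unitary d M -> ip d (apply d M v) (apply d M w) = ip d v w.
Proof.
move=> uM; rewrite /ip /apply.
transitivity (\big[Cadd/C0]_(k < d) \big[Cadd/C0]_(i < d) \big[Cadd/C0]_(j < d)
   Cmul (Cmul (Cconj (v i)) (w j)) (Cmul (Cconj (M k i)) (M k j))).
  apply: eq_bigr => k _; rewrite !CsumE Cconj_sum big_distrl /=.
  apply: eq_bigr => i _; rewrite big_distrr /=; apply: eq_bigr => j _.
  by apply: Cx_eq => /=; ring.
rewrite exchange_big; apply: eq_bigr => i _ /=; rewrite exchange_big /=.
transitivity (\big[Cadd/C0]_(j < d) Cmul (Cmul (Cconj (v i)) (w j)) (if j == i then C1 else C0)).
  apply: eq_bigr => j _; rewrite -big_distrr /=; congr Cmul.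
  have := uM i j (ltP (ltn_ord i)) (ltP (ltn_ord j)); rewrite CsumE => ->.
  by rewrite [j == i]eq_sym; case: (PeanoNat.Nat.eqb_spec i j); case: eqP => // h1 h2; 
     [case: h1; apply: val_inj | case: h2; rewrite h1].
rewrite (bigD1 i) //= eqxx big1 => [|j /negbTE ->]; last by rewrite Cmulx0.
by apply: Cx_eq => /=; ring.
Qed.

Definition rip d (v w : nat -> Cx) : R := re (ip d v w).

Lemma ripE d v w : rip d v w =
  \big[Rplus/0%R]_(k < d) (re (v k) * re (w k) + im (v k) * im (w k))%R.
Proof. by rewrite /rip re_sum; apply: eq_bigr => k _ /=; ring. Qed.

Section Run.
Variables (n m : nat) (U : nat -> nat -> nat -> Cx).
Hypotheses (n_gt0 : 0 < n) (m_gt0 : 0 < m).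
Notation d := (qdim n m).
Notation st := (qstate n m U).

Lemma rip_init G G' : unitary d (U 0) -> rip d (st G 0) (st G' 0) = 1%R.
Proof.
move=> u0; rewrite /rip unitary_ip // re_sum.
have d_gt0 : 0 < d by rewrite /qdim !multE !muln_gt0 n_gt0 m_gt0.
rewrite (bigD1 (Ordinal d_gt0)) //= big1 => [|[k kd]]; first by rewrite /=; lra.
by rewrite -val_eqE /= /e0; case: k kd => // k kd _ /=; lra.
Qed.

Lemma rip_oracle G G' v w : rip d (oracle n m G v) (oracle n m G' w) =
  \big[Rplus/0%R]_(k < d) (phase n m G k * phase n m G' k *
     (re (v k) * re (w k) + im (v k) * im (w k)))%R.
Proof. by rewrite ripE; apply: eq_bigr => k _ /=; ring. Qed.

(** Unitaries preserve inner products, so between two consecutive times only the two oracle phases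
    can change the overlap. *)
Lemma rip_step G G' t : unitary d (U t.+1) ->
  rip d (st G t.+1) (st G' t.+1) =
  \big[Rplus/0%R]_(k < d) (phase n m G k * phase n m G' k *
     (re (st G t k) * re (st G' t k) + im (st G t k) * im (st G' t k)))%R.
Proof. by move=> u; rewrite -rip_oracle /rip -(unitary_ip (oracle n m G _) _ u). Qed.

Lemma phase_sqr G k : (phase n m G k * phase n m G k = 1)%R.
Proof. by rewrite /phase; case: ifP => _; try case: ifP => _; lra. Qed.

Lemma norm_state G t T : (forall s, s <= T -> unitary d (U s)) -> t <= T ->
  \big[Rplus/0%R]_(k < d) Cnorm2 (st G t k) = 1%R.
Proof.
move=> uU; elim: t => [|t IH] tT.
  by rewrite -(rip_init G G (uU 0 (leq0n _))) ripE.
rewrite -IH; last exact: ltnW.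
transitivity (rip d (st G t.+1) (st G t.+1)); first by rewrite ripE.
by rewrite rip_step; [apply: eq_bigr => k _; rewrite phase_sqr Rmult_1_l | exact: uU].
Qed.

(* AM-GM: [2 |a b| <= x a^2 + b^2 / x] *)
Lemma amgm (x a b c e : R) : (0 < x)%R ->
  (Rabs (2 * (a * b + c * e)) <= x * (a * a + c * c) + / x * (b * b + e * e))%R.
Proof.
move=> x0; have ix : (0 < / x)%R by apply: Rinv_0_lt_compat.
have xx : (x * / x = 1)%R by field; lra.
(* For a sign [s] the difference of the two sides is [/ x] times a sum of two squares; the signs 1
   and -1 together give the absolute value. *)
have key s : (s * s = 1)%R ->
    (s * (2 * (a * b + c * e)) <= x * (a * a + c * c) + / x * (b * b + e * e))%R.
  move=> ss.
  have eq : (x * (a * a + c * c) + / x * (b * b + e * e) - s * (2 * (a * b + c * e)) =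
    / x * ((x * a - s * b) * (x * a - s * b) + (x * c - s * e) * (x * c - s * e)))%R.
    transitivity (x * / x * x * (a * a + c * c) + / x * (s * s) * (b * b + e * e)
                  - x * / x * s * (2 * (a * b + c * e)))%R; last by ring.
    by rewrite xx ss; ring.
  have : (0 <= / x * ((x * a - s * b) * (x * a - s * b) + (x * c - s * e) * (x * c - s * e)))%R.
    by apply: Rmult_le_pos; [lra | apply: Rplus_le_le_0_compat; exact: Rle_0_sqr].
  lra.
apply: Rabs_le; split; last by have := key 1%R; lra.
by have := key (-1)%R; lra.
Qed.
End Run.

(** The weight is constant on each class of [l], so the inequality is a count inside every class. It
    will be used with [w] a squared amplitude of the state on one basis vector and [B] the pairs
    separated by the bit queried there. *)
Lemma class_sum_le (K L : finType) (D : {set K}) (l : K -> L) (B : pred K) (w : L -> R) p q :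
  (forall x, 0 <= w x)%R ->
  (forall x, p * #|[set k in D | (l k == x) && B k]| <= q * #|[set k in D | l k == x]|) ->
  (INR p * \big[Rplus/0%R]_(k in D) (if B k then w (l k) else 0%R) <=
   INR q * \big[Rplus/0%R]_(k in D) w (l k))%R.
Proof.
move=> w0 pq.
rewrite -big_mkcondr (partition_big l xpredT) //= [X in (_ <= _ * X)%R](partition_big l xpredT) //=.
rewrite !big_distrr /=; apply: Rsum_le => x _.
have E (P : pred K) : \big[Rplus/0%R]_(k in D | P k && (l k == x)) w (l k) =
     (INR #|[set k in D | (l k == x) && P k]| * w x)%R.
  rewrite -Rsum_const; apply: eq_big => [k|k /andP[_ /andP[_ /eqP ->]] //].
  by rewrite inE [P k && _]andbC.
rewrite [X in (_ * X <= _)%R](eq_bigl (fun k => (k \in D) && (B k && (l k == x)))); last first.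
  by move=> k; rewrite andbA.
rewrite E.
rewrite [X in (_ <= _ * X)%R](eq_bigl (fun k => (k \in D) && (xpredT k && (l k == x)))); last first.
  by move=> k /=.
rewrite E -!Rmult_assoc; apply: Rmult_le_compat_r => //.
rewrite -!mult_INR; apply: le_INR; apply/leP; rewrite !multE.
have -> : [set k in D | (l k == x) && true] = [set k in D | l k == x].
  by apply/setP => k; rewrite !inE andbT.
exact: pq.
Qed.

Section Adversary.
Variables (n : nat) (H : hgraph) (m T : nat) (U : nat -> nat -> nat -> Cx) (out : nat -> bool).
Hypotheses (n_gt0 : 0 < n) (alg : computes_fH n H m T U out).
(** The adversary relation is a family indexed by [D]: the index [k] pairs the rejected input
    [X (l0 k)] with the accepted input [Y (l1 k)]. Loads are measured per label rather than per
    hypergraph, so several labels may carry the same input and weights become multiplicities. *)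
Variables (K L0 L1 : finType) (D : {set K}) (l0 : K -> L0) (l1 : K -> L1).
Variables (X : L0 -> hgraph) (Y : L1 -> hgraph) (p0 q0 p1 q1 : nat).
Hypothesis D_neq0 : 0 < #|D|.
Hypothesis X0 : forall k, k \in D -> ~ contains n H (X (l0 k)).
Hypothesis Y1 : forall k, k \in D -> contains n H (Y (l1 k)).
Let differ a b c k := X (l0 k) a b c != Y (l1 k) a b c.
Hypothesis X_load : forall a b c x, a < b -> b < c -> c < n ->
  p0 * #|[set k in D | (l0 k == x) && differ a b c k]| <= q0 * #|[set k in D | l0 k == x]|.
Hypothesis Y_load : forall a b c y, a < b -> b < c -> c < n ->
  p1 * #|[set k in D | (l1 k == y) && differ a b c k]| <= q1 * #|[set k in D | l1 k == y]|.
Hypotheses (p0_gt0 : 0 < p0) (p1_gt0 : 0 < p1) (q0_gt0 : 0 < q0) (q1_gt0 : 0 < q1).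

Notation d := (qdim n m).
Notation st := (qstate n m U).

Let m_gt0 : 0 < m. Proof. by case: alg => /ltP. Qed.
Let uU t : t <= T -> unitary d (U t).
Proof. by case: alg => _ [u _] /leP; apply: u. Qed.

(** The index [z] is decoded exactly as in [phase]; null queries separate no pair. *)
Let dz (z : nat) (k : K) : bool :=
  let q := PeanoNat.Nat.div z m in
  let a := PeanoNat.Nat.div q (PeanoNat.Nat.mul n n) in
  let b := PeanoNat.Nat.modulo (PeanoNat.Nat.div q n) n in
  let c := PeanoNat.Nat.modulo q n in
  (PeanoNat.Nat.ltb a b && PeanoNat.Nat.ltb b c) && differ a b c k.

Let phaseM k z : (phase n m (X (l0 k)) z * phase n m (Y (l1 k)) z =
  if dz z k then -1 else 1)%R.
Proof.
rewrite /phase /dz /differ; case: (_ && _) => /=; last by ring.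
by case: (X _ _ _ _); case: (Y _ _ _ _) => /=; ring.
Qed.

Let dz_load (L : finType) (l : K -> L) p q z :
  (forall a b c x, a < b -> b < c -> c < n ->
    p * #|[set k in D | (l k == x) && differ a b c k]| <= q * #|[set k in D | l k == x]|) ->
  forall x, p * #|[set k in D | (l k == x) && dz z k]| <= q * #|[set k in D | l k == x]|.
Proof.
move=> load x; rewrite /dz.
set a := PeanoNat.Nat.div _ (PeanoNat.Nat.mul _ _).
set b := PeanoNat.Nat.modulo (PeanoNat.Nat.div _ n) n; set c := PeanoNat.Nat.modulo _ n.
case E: (_ && _) => /=.
  case/andP: E => /PeanoNat.Nat.ltb_lt/ltP ab /PeanoNat.Nat.ltb_lt/ltP bc.
  apply: load => //; apply/ltP; apply: PeanoNat.Nat.mod_upper_bound.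
  by move=> n0; move: n_gt0; rewrite n0.
have -> : [set k in D | (l k == x) && false] = set0.
  by apply/setP => k; rewrite !inE !andbF.
by rewrite cards0 muln0.
Qed.

(** The progress measure: it starts at the number of pairs, loses a bounded amount per query, and
    must finish below a fixed fraction of its initial value. *)
Let Phi t := \big[Rplus/0%R]_(k in D) rip d (st (X (l0 k)) t) (st (Y (l1 k)) t).

Let ND := INR #|D|.
Let ND_gt0 : (0 < ND)%R.
Proof. by apply: lt_0_INR; apply/ltP. Qed.

(** Apply [class_sum_le] on each basis vector and sum: the states have norm 1, so the total weight
    is the number of pairs. *)
Let load_total (L : finType) (l : K -> L) (Z : L -> hgraph) p q t :
  (forall a b c x, a < b -> b < c -> c < n ->
    p * #|[set k in D | (l k == x) && differ a b c k]| <= q * #|[set k in D | l k == x]|) ->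
  t <= T ->
  (INR p * \big[Rplus/0%R]_(k in D) \big[Rplus/0%R]_(z < d)
      (if dz z k then Cnorm2 (st (Z (l k)) t z) else 0) <= INR q * ND)%R.
Proof.
move=> load tT; rewrite exchange_big big_distrr /=.
apply: (@Rle_trans _ (\big[Rplus/0%R]_(z < d) (INR q *
    \big[Rplus/0%R]_(k in D) Cnorm2 (st (Z (l k)) t z)))%R).
  apply: Rsum_le => z _; apply: (class_sum_le (w := fun x => Cnorm2 (st (Z x) t z))).
    by move=> x; rewrite /Cnorm2; nra.
  exact: dz_load.
rewrite -big_distrr exchange_big /=.
rewrite (eq_bigr (fun=> 1%R)) => [|k _]; first by rewrite Rsum_const /ND; lra.
exact: (norm_state n_gt0 m_gt0 _ uU).
Qed.

(** A query changes the sign of an overlap term exactly where [dz] holds, which costs twice that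
    term. [amgm] splits this cost between the rejected and the accepted side, with a ratio [x] left
    free for later optimisation. *)
Let Phi_step (x : R) t : (0 < x)%R -> t < T ->
  (Phi t - ND * (x * (INR q0 / INR p0) + / x * (INR q1 / INR p1)) <= Phi t.+1)%R.
Proof.
move=> x0 tT; have ix : (0 < / x)%R by apply: Rinv_0_lt_compat.
set A := \big[Rplus/0%R]_(k in D) \big[Rplus/0%R]_(z < d)
      (if dz z k then Cnorm2 (st (X (l0 k)) t z) else 0%R).
set B := \big[Rplus/0%R]_(k in D) \big[Rplus/0%R]_(z < d)
      (if dz z k then Cnorm2 (st (Y (l1 k)) t z) else 0%R).
have P0 : (0 < INR p0)%R by apply: lt_0_INR; apply/ltP.
have P1 : (0 < INR p1)%R by apply: lt_0_INR; apply/ltP.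
have leA : (A <= ND * (INR q0 / INR p0))%R.
  apply: (Rmult_le_reg_l (INR p0)) => //; have := load_total (l := l0) X X_load (ltnW tT).
  rewrite -/A; suff -> : (INR p0 * (ND * (INR q0 / INR p0)) = INR q0 * ND)%R by [].
  by field; lra.
have leB : (B <= ND * (INR q1 / INR p1))%R.
  apply: (Rmult_le_reg_l (INR p1)) => //; have := load_total (l := l1) Y Y_load (ltnW tT).
  rewrite -/B; suff -> : (INR p1 * (ND * (INR q1 / INR p1)) = INR q1 * ND)%R by [].
  by field; lra.
suff main : (Phi t <= Phi t.+1 + (x * A + / x * B))%R.
  have := Rmult_le_compat_l _ _ _ (Rlt_le _ _ x0) leA.
  have := Rmult_le_compat_l _ _ _ (Rlt_le _ _ ix) leB.
  lra.
rewrite /Phi /A /B !big_distrr -!big_split /=; apply: Rsum_le => k kD.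
rewrite rip_step; last exact: uU.
rewrite ripE !big_distrr -!big_split /=; apply: Rsum_le => z _.
rewrite phaseM; case: (dz z k); last by lra.
have := amgm (re (st (X (l0 k)) t z)) (re (st (Y (l1 k)) t z))
           (im (st (X (l0 k)) t z)) (im (st (Y (l1 k)) t z)) x0.
set r := (_ + _)%R; rewrite /Cnorm2 => /(Rle_trans _ _ _ (Rle_abs _)) h.
move: h; rewrite /r; lra.
Qed.

Let Phi0 : Phi 0 = ND.
Proof.
rewrite /Phi (eq_bigr (fun=> 1%R)) => [|k _]; first by rewrite Rsum_const /ND; lra.
exact: (rip_init n_gt0 m_gt0 _ _ (uU (leq0n T))).
Qed.

Let Phi_lower x t : (0 < x)%R -> t <= T ->
  (ND - INR t * (ND * (x * (INR q0 / INR p0) + / x * (INR q1 / INR p1))) <= Phi t)%R.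
Proof.
move=> x0; elim: t => [|t IH] tT; first by rewrite Phi0 /=; lra.
have := Phi_step x0 tT; have := IH (ltnW tT); rewrite S_INR; lra.
Qed.

(* The weights 3/2 and 2/3 on the two outcomes separate acceptance probabilities 1/3 and 2/3. *)
Let Phi_final : (Phi T <= 17 / 18 * ND)%R.
Proof.
suff bd k : k \in D -> (rip d (st (X (l0 k)) T) (st (Y (l1 k)) T) <= 17 / 18)%R.
  apply: (@Rle_trans _ (\big[Rplus/0%R]_(k in D) (17 / 18)%R)); first exact: Rsum_le.
  by rewrite Rsum_const /ND; lra.
move=> kD; set x := X (l0 k); set y := Y (l1 k).
have px : (prob1 n m U out x T <= 1/3)%R by case: alg => _ [_ /(_ x) [_ h]]; apply: h; apply: X0.
have py : (prob1 n m U out y T >= 2/3)%R by case: alg => _ [_ /(_ y) [h _]]; apply: h; apply: Y1.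
have nx := norm_state n_gt0 m_gt0 x uU (leqnn T).
have ny := norm_state n_gt0 m_gt0 y uU (leqnn T).
rewrite /prob1 RsumE in px; rewrite /prob1 RsumE in py.
set Px := \big[_/_]_(i < _) _ in px; set Py := \big[_/_]_(i < _) _ in py.
(* Where [out] is true the weights are 3/2 on [x] and 2/3 on [y], elsewhere they are exchanged. With
   [Px <= 1/3] and [Py >= 2/3] the right side is at most 13/6 - 5/18 = 17/9. *)
suff : (2 * rip d (st x T) (st y T) <=
   (3/2 - 2/3) * Px + (2/3 - 3/2) * Py + (2/3) * 1 + (3/2) * 1)%R by lra.
rewrite -{1}nx -ny /Px /Py ripE !big_distrr -!big_split /=; apply: Rsum_le => z _.
have pos : (0 < 3/2)%R by lra.
have := amgm (re (st x T z)) (re (st y T z)) (im (st x T z)) (im (st y T z)) pos.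
have := amgm (re (st y T z)) (re (st x T z)) (im (st y T z)) (im (st x T z)) pos.
have -> : (/ (3/2) = 2/3)%R by field.
set r := (_ + _)%R; set r' := (_ + _)%R; rewrite /Cnorm2.
move=> /(Rle_trans _ _ _ (Rle_abs _)) h1 /(Rle_trans _ _ _ (Rle_abs _)) h2.
by move: h1 h2; rewrite /r /r'; case: (out z) => h1 h2; lra.
Qed.

Theorem adversary_bound : p0 * p1 <= 1296 * (q0 * q1) * (T * T).
Proof.
have P0 : (0 < INR p0)%R by apply: lt_0_INR; apply/ltP.
have P1 : (0 < INR p1)%R by apply: lt_0_INR; apply/ltP.
have Q0 : (0 < INR q0)%R by apply: lt_0_INR; apply/ltP.
have Q1 : (0 < INR q1)%R by apply: lt_0_INR; apply/ltP.
set a := (INR q0 / INR p0)%R; set b := (INR q1 / INR p1)%R.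
have a0 : (0 < a)%R by apply: Rdiv_lt_0_compat.
have b0 : (0 < b)%R by apply: Rdiv_lt_0_compat.
have step x : (0 < x)%R -> (1 <= 18 * INR T * (x * a + / x * b))%R.
  move=> x0; have := Phi_lower x0 (leqnn T); have := Phi_final; rewrite -/a -/b => h1 h2.
  apply: (Rmult_le_reg_l ND) => //; lra.
have T0 : (0 < INR T)%R.
  case: (Req_dec (INR T) 0) => [T0|]; last by have := pos_INR T; lra.
  by have := step 1%R ltac:(lra); rewrite T0; lra.
(* This [x] makes the first of the two terms in [step] equal to 1/2; the other one is then
   [648 T^2 a b], whence the constant 1296. *)
have x0 : (0 < / (36 * INR T * a))%R by apply: Rinv_0_lt_compat; nra.
have {step} := step _ x0; rewrite Rinv_inv.
have -> : (18 * INR T * (/ (36 * INR T * a) * a + 36 * INR T * a * b) =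
           / 2 + 648 * (INR T * INR T) * (a * b))%R by field; lra.
move=> main; apply/leP; apply: INR_le.
rewrite -!multE !mult_INR.
have -> : INR 1296 = 1296%R by rewrite INR_IZR_INZ.
have e : (INR p0 * INR p1 * (a * b) = INR q0 * INR q1)%R by rewrite /a /b; field; lra.
have pp : (0 < INR p0 * INR p1)%R by nra.
have : (INR p0 * INR p1 * (1 / 2) <=
   INR p0 * INR p1 * (648 * (INR T * INR T) * (a * b)))%R.
  by apply: Rmult_le_compat_l; lra.
have -> : (INR p0 * INR p1 * (648 * (INR T * INR T) * (a * b)) =
   648 * (INR T * INR T) * (INR p0 * INR p1 * (a * b)))%R by ring.
rewrite e; lra.
Qed.
End Adversary.

(** * Hypergraphs as sets of vertex sets *)

Section Encoding.
Variable n' : nat.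
Notation n := n'.+1.
Notation hyp := {set {set 'I_n}}.

Definition graph_of (E : hyp) : hgraph :=
  fun a b c => [set inord a; inord b; inord c] \in E.

(** Only the bits at increasing triples are read, so the meaningless values of [H] leave no
    trace. *)
Definition edges (H : hgraph) : hyp :=
  [set e | [exists a : 'I_n, exists b : 'I_n, exists c : 'I_n,
     [&& a < b, b < c, H a b c & e == [set a; b; c]]]].

Definition embeds (F E : hyp) : bool := [exists s : 'S_n, [forall e in F, (s @: e) \in E]].

Lemma edgesP (H : hgraph) (e : {set 'I_n}) :
  reflect (exists a b c : 'I_n, [/\ a < b, b < c, H a b c & e = [set a; b; c]]) (e \in edges H).
Proof.
rewrite inE; apply: (iffP existsP) => [[a /existsP[b /existsP[c /and4P[ab bc h /eqP ->]]]]|].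
  by exists a, b, c.
case=> a [b [c [ab bc h ->]]]; exists a; apply/existsP; exists b; apply/existsP; exists c.
by rewrite ab bc h eqxx.
Qed.

Lemma cards3 (T : finType) (x y z : T) : x != y -> y != z -> x != z -> #|[set x; y; z]| = 3.
Proof.
by move=> xy yz xz; rewrite setUC cardsU1 cards2 !inE xy negb_or ![z == _]eq_sym xz yz.
Qed.

Lemma edges_card3 (H : hgraph) e : e \in edges H -> #|e| = 3.
Proof.
by case/edgesP => a [b [c [ab bc _ ->]]]; rewrite cards3 // -val_eqE /=; lia.
Qed.

Lemma hasE_graph_of (E : hyp) x y z :
  hasE (graph_of E) x y z = ([set inord x; inord y; inord z] \in E).
Proof.
rewrite /hasE /graph_of; congr (_ \in E); apply/setP => i; rewrite !inE.
have := sort3_cases x y z; move: (min3 x y z) (mid3 x y z) (max3 x y z) => a b c h.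
by case: h => [|[|[|[|[|]]]]] [-> [-> ->]];
   case: (i == inord x); case: (i == inord y); case: (i == inord z).
Qed.

(** An injection of a finite vertex set into itself is a permutation, and [hasE] does not depend on
    the order of its arguments. *)
Lemma contains_embeds (H : hgraph) (E : hyp) :
  contains n H (graph_of E) <-> embeds (edges H) E.
Proof.
split.
- case=> f [fn [finj fH]].
  have finj' : injective (fun i : 'I_n => inord (f i) : 'I_n).
    move=> i j /(congr1 val); rewrite /= !inordK; try exact/ltP/fn/ltP.
    by move=> /(finj _ _ (ltP (ltn_ord i)) (ltP (ltn_ord j))); apply: val_inj.
  apply/existsP; exists (perm finj'); apply/forall_inP => e /edgesP[a [b [c [ab bc h ->]]]].
  have := fH a b c (ltP ab) (ltP bc) (ltP (ltn_ord c)) h.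
  by rewrite hasE_graph_of !imsetU !imset_set1 !permE.
case/existsP=> s /forall_inP sH.
exists (fun i => s (inord i) : nat); split; [|split].
- by move=> i _; apply/ltP.
- move=> i j /ltP iN /ltP jN /val_inj /perm_inj /(congr1 val).
  by rewrite /= !inordK.
move=> a b c /ltP ab /ltP bc /ltP cn h.
have bn := ltn_trans bc cn; have an := ltn_trans ab bn.
rewrite hasE_graph_of !inord_val.
have -> : [set s (inord a); s (inord b); s (inord c)] = s @: [set inord a; inord b; inord c].
  by rewrite !imsetU !imset_set1.
apply: sH; apply/edgesP; exists (inord a), (inord b), (inord c).
by split; rewrite ?inordK.
Qed.

(** All that is retained of the algorithm: from here on the argument is purely combinatorial. Zero
    values of [p0] and [p1] are allowed because the conclusion is then trivial. *)
Definition adversary_bounded (T : nat) (F : hyp) : Prop :=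
  forall (K L0 L1 : finType) (D : {set K}) (l0 : K -> L0) (l1 : K -> L1)
    (X : L0 -> hyp) (Y : L1 -> hyp) (p0 q0 p1 q1 : nat),
  0 < #|D| ->
  (forall k, k \in D -> ~~ embeds F (X (l0 k))) ->
  (forall k, k \in D -> embeds F (Y (l1 k))) ->
  (forall (e : {set 'I_n}) x, #|e| = 3 ->
    p0 * #|[set k in D | (l0 k == x) && ((e \in X (l0 k)) != (e \in Y (l1 k)))]|
      <= q0 * #|[set k in D | l0 k == x]|) ->
  (forall (e : {set 'I_n}) y, #|e| = 3 ->
    p1 * #|[set k in D | (l1 k == y) && ((e \in X (l0 k)) != (e \in Y (l1 k)))]|
      <= q1 * #|[set k in D | l1 k == y]|) ->
  0 < q0 -> 0 < q1 ->
  p0 * p1 <= 1296 * (q0 * q1) * (T * T).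

Lemma computes_adversary_bounded (H : hgraph) m T U out :
  computes_fH n H m T U out -> adversary_bounded T (edges H).
Proof.
move=> alg K L0 L1 D l0 l1 X Y p0 q0 p1 q1 D0 X0 Y1 Xl Yl q00 q10.
case: (posnP p0) => [->|p00]; first by rewrite mul0n.
case: (posnP p1) => [->|p10]; first by rewrite muln0.
have card a b c : a < b -> b < c -> c < n ->
    #|[set (inord a : 'I_n); inord b; inord c]| = 3.
  move=> ab bc cn; have bn := ltn_trans bc cn; have an := ltn_trans ab bn.
  by rewrite cards3 // -val_eqE /= !inordK //; lia.
apply: (@adversary_bound n H m T U out _ alg K L0 L1 D l0 l1
  (fun x => graph_of (X x)) (fun y => graph_of (Y y))) => //.
- by move=> k kD /contains_embeds; apply/negP; apply: X0.
- by move=> k kD; apply/contains_embeds; apply: Y1.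
- by move=> a b c x ab bc cn; apply: Xl; apply: card.
by move=> a b c x ab bc cn; apply: Yl; apply: card.
Qed.
End Encoding.

(** * Minterms, vertex thresholds and sparse vertex subsets *)

(** With [n = k + 3] this compares [n^2] with [(n-1)(n-2)], with equality at [n = 3]; it turns a
    falling factorial into [n^3]. *)
Lemma sqr_falling_le k : 2 * (k.+3 * k.+3) <= 9 * (k.+2 * k.+1).
Proof.
rewrite (_ : 9 * _ = 2 * (k.+3 * k.+3) + (7 * (k * k) + 15 * k)); last by lia.
exact: leq_addr.
Qed.

Lemma sixth_power q : q ^ 6 = (q * q) * ((q * q) * (q * q)).
Proof. by rewrite !expnS expn0; lia. Qed.

Lemma subset_of_card (T : finType) (A : {set T}) k : k <= #|A| ->
  exists2 B : {set T}, B \subset A & #|B| = k.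
Proof.
move=> kA; exists [set x in take k (enum A)].
  by apply/subsetP => x; rewrite inE => /mem_take; rewrite mem_enum.
rewrite cardsE (card_uniqP _) ?take_uniq ?enum_uniq // size_take -cardE.
by rewrite ltn_neqAle kA andbT; case: eqP => [->|].
Qed.

Lemma perm_of_seqs (T : finType) (s1 s2 : seq T) : uniq s1 -> uniq s2 -> size s1 = size s2 ->
  exists p : {perm T}, map p s1 = s2.
Proof.
move=> u1 u2 es.
(* Both sequences are completed to enumerations of [T], and [f] matches them position by position;
   the default of [nth] is never reached. *)
pose ext s := s ++ filter [predC s] (enum T).
have extP s : uniq s -> uniq (ext s) /\ (forall x, x \in ext s).
  move=> us; split=> [|x].
    rewrite cat_uniq us filter_uniq ?enum_uniq // andbT.
    by apply/hasPn => x; rewrite mem_filter => /andP[].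
  by rewrite mem_cat mem_filter mem_enum andbT /= orbN.
have [ue1 me1] := extP _ u1; have [ue2 me2] := extP _ u2.
have sz s : uniq (ext s) -> (forall x, x \in ext s) -> size (ext s) = #|T|.
  by move=> us ms; rewrite -(card_uniqP us); apply: eq_card.
have e12 : size (ext s1) = size (ext s2) by rewrite !sz.
pose f x := nth x (ext s2) (index x (ext s1)).
have f_inj : injective f.
  move=> x y; rewrite /f.
  have ix : index x (ext s1) < size (ext s2) by rewrite -e12 index_mem.
  have iy : index y (ext s1) < size (ext s2) by rewrite -e12 index_mem.
  rewrite (set_nth_default y x) // => /eqP; rewrite nth_uniq // => /eqP e.
  by rewrite -(nth_index x (me1 x)) e nth_index.
exists (perm f_inj).
case: s1 s2 u1 u2 es @ext extP ue1 me1 ue2 me2 sz e12 @f f_inj => [|x0 s1] s2 u1 u2 es.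
  by case: s2 u2 es.
move=> ext extP ue1 me1 ue2 me2 sz e12 f f_inj.
apply: (@eq_from_nth _ x0); first by rewrite size_map.
move=> i; rewrite size_map => is1; rewrite (nth_map x0) // permE /f.
have -> : index (nth x0 (x0 :: s1) i) (ext (x0 :: s1)) = i.
  by rewrite /ext index_cat mem_nth // index_uniq.
rewrite /ext nth_cat -es is1; apply: set_nth_default; by rewrite -es.
Qed.

Lemma perm_of_sets3 (T : finType) (A1 A2 A3 B1 B2 B3 : {set T}) :
  [disjoint A1 & A2] -> [disjoint A1 & A3] -> [disjoint A2 & A3] ->
  [disjoint B1 & B2] -> [disjoint B1 & B3] -> [disjoint B2 & B3] ->
  #|A1| = #|B1| -> #|A2| = #|B2| -> #|A3| = #|B3| ->
  exists p : {perm T}, [/\ p @: A1 = B1, p @: A2 = B2 & p @: A3 = B3].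
Proof.
move=> a12 a13 a23 b12 b13 b23 c1 c2 c3.
have u (C1 C2 C3 : {set T}) : [disjoint C1 & C2] -> [disjoint C1 & C3] -> [disjoint C2 & C3] ->
    uniq (enum C1 ++ (enum C2 ++ enum C3)).
  move=> d12 d13 d23; rewrite !cat_uniq !enum_uniq /= !andbT.
  apply/andP; split.
    apply/hasPn => x; rewrite mem_cat !mem_enum => x23.
    apply/negP => x1; case/orP: x23 => x2.
      by rewrite (disjointFr d12 x1) in x2.
    by rewrite (disjointFr d13 x1) in x2.
  apply/hasPn => x; rewrite !mem_enum => x3; apply/negP => x2.
  by rewrite (disjointFr d23 x2) in x3.
have [|p] := perm_of_seqs (u _ _ _ a12 a13 a23) (u _ _ _ b12 b13 b23).
  by rewrite !size_cat -!cardE c1 c2 c3.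
rewrite !map_cat => /eqP; rewrite eqseq_cat ?size_map -?cardE // => /andP[/eqP e1].
rewrite eqseq_cat ?size_map -?cardE // => /andP[/eqP e2 /eqP e3].
have im (A B : {set T}) : map p (enum A) = enum B -> p @: A = B.
  move=> e; apply/setP => x; apply/imsetP/idP => [[y yA ->]|xB].
    by rewrite -mem_enum -e map_f // mem_enum.
  by move: xB; rewrite -mem_enum -e => /mapP[y]; rewrite mem_enum; exists y.
by exists p; split; apply: im.
Qed.

Section Families.
Variable n' : nat.
Notation n := n'.+1.
Notation hyp := {set {set 'I_n}}.
Implicit Types (E F : hyp) (A C W S e : {set 'I_n}).

Definition touch A : hyp := [set e : {set 'I_n} | e :&: A != set0].

Lemma touchP A e : reflect (exists2 x, x \in e & x \in A) (e \in touch A).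
Proof.
rewrite inE; apply: (iffP (set0Pn _)) => [[x]|[x xe xA]]; last by exists x; rewrite inE xe.
by rewrite inE => /andP[]; exists x.
Qed.

(** This is the image of [E] under [s], written as a preimage so that membership of [e] reduces to
    membership in [E]. *)
Definition conj_hyp (s : 'S_n) E : hyp := [set e : {set 'I_n} | (s^-1)%g @: e \in E].

Lemma perm_imsetM (s t : 'S_n) (e : {set 'I_n}) : (s * t)%g @: e = t @: (s @: e).
Proof. by rewrite -imset_comp; apply: eq_imset => i; rewrite permM. Qed.

Lemma perm_imset1 (e : {set 'I_n}) : (1%g : 'S_n) @: e = e.
Proof.
by rewrite -[RHS]imset_id; apply: eq_imset => i; rewrite perm1.
Qed.

Lemma perm_imsetK (s : 'S_n) : cancel (fun e : {set 'I_n} => s @: e) (fun e => (s^-1)%g @: e).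
Proof. by move=> e; rewrite -perm_imsetM mulgV perm_imset1. Qed.

Lemma card_perm_imset (s : 'S_n) (e : {set 'I_n}) : #|s @: e| = #|e|.
Proof. by rewrite card_imset //; apply: perm_inj. Qed.

Lemma in_conj_hyp (s : 'S_n) E e : (e \in conj_hyp s E) = ((s^-1)%g @: e \in E).
Proof. by rewrite inE. Qed.

Lemma conj_hypM (s t : 'S_n) E : conj_hyp (s * t)%g E = conj_hyp t (conj_hyp s E).
Proof. by apply/setP => e; rewrite !inE invMg perm_imsetM. Qed.

Section Fixed.
Variables (T : nat) (F : hyp).
Hypothesis F3 : forall e, e \in F -> #|e| = 3.
Notation emb := (embeds F).

Lemma embeds_mono E E' : (forall e, #|e| = 3 -> e \in E -> e \in E') -> emb E -> emb E'.
Proof.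
move=> sub /existsP[s /forall_inP sE]; apply/existsP; exists s; apply/forall_inP => e eF.
by apply: sub; [rewrite card_perm_imset F3 | apply: sE].
Qed.

Lemma embeds_conj s E : emb (conj_hyp s E) = emb E.
Proof.
apply/existsP/existsP => -[t /forall_inP tE].
  by exists (t * s^-1)%g; apply/forall_inP => e /tE; rewrite inE perm_imsetM.
by exists (t * s)%g; apply/forall_inP => e /tE; rewrite inE -perm_imsetM mulgK.
Qed.

Hypothesis adv : adversary_bounded T F.
Notation Q := (36 * T).

(** Since 1296 is the square of 36, the constant is absorbed into [Q]. *)
Lemma adversary_boundedQ (K L0 L1 : finType) (D : {set K}) (l0 : K -> L0) (l1 : K -> L1)
    (X : L0 -> hyp) (Y : L1 -> hyp) (p0 q0 p1 q1 : nat) :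
  0 < #|D| ->
  (forall k, k \in D -> ~~ embeds F (X (l0 k))) ->
  (forall k, k \in D -> embeds F (Y (l1 k))) ->
  (forall (e : {set 'I_n}) x, #|e| = 3 ->
    p0 * #|[set k in D | (l0 k == x) && ((e \in X (l0 k)) != (e \in Y (l1 k)))]|
      <= q0 * #|[set k in D | l0 k == x]|) ->
  (forall (e : {set 'I_n}) y, #|e| = 3 ->
    p1 * #|[set k in D | (l1 k == y) && ((e \in X (l0 k)) != (e \in Y (l1 k)))]|
      <= q1 * #|[set k in D | l1 k == y]|) ->
  0 < q0 -> 0 < q1 ->
  p0 * p1 <= q0 * q1 * (Q * Q).
Proof.
move=> h1 h2 h3 h4 h5 h6 h7; apply: leq_trans (adv h1 h2 h3 h4 h5 h6 h7) _.
rewrite [Q * Q]mulnACA [1296 * _]mulnC -mulnA; exact: leqnn.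
Qed.

Hypothesis F_neq0 : 0 < #|F|.

Lemma embeds_refl : emb F.
Proof. by apply/existsP; exists 1%g; apply/forall_inP => e; rewrite perm_imset1. Qed.

Lemma embeds_card E : emb E -> #|F| <= #|E|.
Proof.
case/existsP=> s /forall_inP sE.
rewrite -(card_imset _ (can_inj (perm_imsetK s))) subset_leq_card //.
by apply/subsetP => _ /imsetP[e eF ->]; apply: sE.
Qed.

(** Each [F :\ e], which has too few edges to contain a copy of [F], is paired with [F]. A given bit
    separates only one of the [#|F|] pairs at [F]. *)
Lemma minterm_bound : #|F| <= Q * Q.
Proof.
rewrite -[X in _ <= X]mul1n -[X in X <= _]mul1n -[X in _ <= X * _]muln1.
apply: (@adversary_boundedQ {set 'I_n} {set 'I_n} unit F id (fun=> tt) (fun e => F :\ e) (fun=> F)) => //.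
- move=> k kF; apply/negP => /embeds_card.
  by rewrite [in X in X <= _](cardsD1 k) kF add1n ltnn.
- by move=> k _; apply: embeds_refl.
- move=> e x _; rewrite !mul1n subset_leq_card //; apply/subsetP => k.
  by rewrite !inE => /and3P[-> -> _].
move=> e [] _; rewrite mul1n.
have -> : [set k in F | tt == tt] = F by apply/setP => k; rewrite inE andbT.
rewrite -{2}[#|F|]muln1 leq_mul2l; apply/orP; right.
rewrite -(cards1 e) subset_leq_card //; apply/subsetP => k.
by rewrite !inE => /and3P[_ _]; apply: contraR; rewrite eq_sym => ->.
Qed.

Lemma query_pos : 0 < T.
Proof. by have := leq_trans F_neq0 minterm_bound; rewrite lt0n; case: T. Qed.

Variables (tau : nat) (C0 : {set 'I_n}).
Hypotheses (C0_cover : F \subset touch C0) (C0_card : #|C0| = tau).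
Hypothesis tau_min : forall C, F \subset touch C -> tau <= #|C|.

(** Pulling [A] back along an embedding gives a cover of [F] of the same size. *)
Lemma embeds_touch A : #|A| < tau -> ~~ emb (touch A).
Proof.
move=> Atau; apply/negP => /existsP[s /forall_inP sA].
suff /tau_min : F \subset touch ((s^-1)%g @: A) by rewrite card_perm_imset leqNgt Atau.
apply/subsetP => e /sA /touchP[_ /imsetP[x xe ->] sxA]; apply/touchP; exists x => //.
by rewrite -(permK s x) imset_f.
Qed.

Lemma embeds_touch_tau A : #|A| = tau -> emb (touch A).
Proof.
move=> Atau; have d0 (B : {set 'I_n}) : [disjoint B & (set0 : {set 'I_n})].
  by rewrite disjoint_sym; apply/pred0P => x; rewrite /= inE.
have d0' : [disjoint (set0 : {set 'I_n}) & (set0 : {set 'I_n})] by apply: d0.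
have [|s [sC _ _]] := perm_of_sets3 (d0 C0) (d0 C0) d0' (d0 A) (d0 A) d0' _ erefl erefl.
  by rewrite C0_card.
apply/existsP; exists s; apply/forall_inP => e /(subsetP C0_cover) /touchP[x xe xC].
by apply/touchP; exists (s x); rewrite ?imset_f // -sC imset_f.
Qed.

Lemma tau_gt0 : 0 < tau.
Proof.
rewrite lt0n; apply/eqP => t0; have /eqP := C0_card; rewrite t0 cards_eq0 => /eqP C00.
have [e eF] := card_gt0P F_neq0.
by have /touchP[x _] := subsetP C0_cover _ eF; rewrite C00 inE.
Qed.

Lemma tau_le_n : tau <= n.
Proof. by rewrite -C0_card; have := max_card (mem C0); rewrite card_ord. Qed.

(** The pairs are [touch (W :\ w)] and [touch W] with [#|W| = tau]. A triple [e] separates them only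
    if [w] lies in [e], so at most 3 of the [n - tau + 1] extensions of [W :\ w], and at most 3 of
    the [tau] deletions from [W], are affected. *)
Lemma threshold_bound : (n - tau).+1 * tau <= 9 * (Q * Q).
Proof.
have tn := tau_le_n; have t0 := tau_gt0.
pose D := [set k : {set 'I_n} * 'I_n | (#|k.1| == tau) && (k.2 \in k.1)].
apply: (@adversary_boundedQ _ _ _ D (fun k => k.1 :\ k.2) (fun k => k.1) touch touch _ 3 _ 3) => //.
- have [W _ Wt] := @subset_of_card _ [set: 'I_n] tau ltac:(by rewrite cardsT card_ord).
  have /card_gt0P[w wW] : 0 < #|W| by rewrite Wt.
  by apply/card_gt0P; exists (W, w); rewrite inE /= Wt eqxx.
- move=> [W w]; rewrite inE /= => /andP[/eqP Wt wW]; apply: embeds_touch.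
  by rewrite -Wt (cardsD1 w W) wW.
- by move=> [W w]; rewrite inE /= => /andP[/eqP Wt wW]; apply: embeds_touch_tau.
- move=> e x e3; case: (eqVneq #|x| tau.-1) => xt; last first.
    rewrite (_ : [set k in D | _ & _] = set0) ?cards0 ?muln0 //.
    apply/setP => -[W w]; rewrite !inE /=; apply/negP => /andP[/andP[/eqP Wt wW] /andP[/eqP Wx _]].
    by move: xt; rewrite -Wx -Wt (cardsD1 w W) wW eqxx.
  rewrite mulnC leq_mul //.
    rewrite -e3; apply: leq_trans (leq_imset_card (fun w => (w |: x, w)) e).
    rewrite subset_leq_card //; apply/subsetP => -[W w]; rewrite !inE /=.
    case/andP=> /andP[_ wW] /andP[/eqP Wx ne]; apply/imsetP; exists w; last first.
      by rewrite -Wx setD1K.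
    apply: contraR ne => we; apply/eqP; congr (_ != _).
    by apply/setP => i; rewrite !inE; case: eqP => [->|] //; rewrite (negbTE we).
  have -> : (n - tau).+1 = #|~: x|.
    by have := cardsC x; rewrite card_ord xt; lia.
  rewrite -(@card_imset _ _ (fun w => (w |: x, w))); last by move=> a b [].
  rewrite subset_leq_card //; apply/subsetP => _ /imsetP[w wx ->].
  rewrite inE in wx; rewrite !inE /= eqxx /= cardsU1 wx xt add1n prednK // eqxx /=.
  by rewrite setU1K.
move=> e y e3; case: (eqVneq #|y| tau) => yt; last first.
  rewrite (_ : [set k in D | _ & _] = set0) ?cards0 ?muln0 //.
  apply/setP => -[W w]; rewrite !inE /=; apply/negP => /andP[/andP[Wt _] /andP[/eqP Wy _]].
  by move: yt; rewrite -Wy Wt.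
rewrite mulnC leq_mul //.
  rewrite -e3; apply: leq_trans (leq_imset_card (fun w => (y, w)) e).
  rewrite subset_leq_card //; apply/subsetP => -[W w]; rewrite !inE /=.
  case/andP=> /andP[_ wW] /andP[/eqP Wx ne]; apply/imsetP; exists w; last by rewrite Wx.
  apply: contraR ne => we; apply/eqP; congr (_ != _).
  by apply/setP => i; rewrite !inE; case: eqP => [->|] //; rewrite (negbTE we).
rewrite -[X in X <= _]yt -(@card_imset _ _ (fun w => (y, w))); last by move=> a b [].
rewrite subset_leq_card //; apply/subsetP => _ /imsetP[w wx ->].
by rewrite !inE /= yt !eqxx wx.
Qed.

Definition inside S : hyp := [set e in F | e \subset S].

(** Double counting: an edge inside [S] survives the deletion of each of the [#|S| - 3] vertices off
    it. *)
Lemma sum_inside_delete S : \sum_(u in S) #|inside (S :\ u)| = (#|S| - 3) * #|inside S|.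
Proof.
transitivity (\sum_(u in S) \sum_(e in inside S) (u \notin e)).
  apply: eq_bigr => u uS; rewrite -sum1_card big_mkcond [RHS]big_mkcond /=.
  apply: eq_bigr => e _; rewrite !inE subsetD1.
  by case: (e \in F); case: (e \subset S); case: (u \in e).
rewrite exchange_big /= mulnC -sum_nat_const; apply: eq_bigr => e.
rewrite inE => /andP[eF eS]; rewrite -(F3 eF).
have -> : #|S| - #|e| = #|S :\: e| by rewrite cardsD (setIidPr eS).
rewrite -sum1_card [RHS]big_mkcond [LHS]big_mkcond /=; apply: eq_bigr => u _.
by rewrite !inE; case: (u \in S); case: (u \in e).
Qed.

(** Vertices are deleted one at a time. By [sum_inside_delete] some vertex can be removed without
    increasing the edge density, measured against the falling factorial of order 3. *)
Lemma sparse_subset k : k <= n -> exists2 S : {set 'I_n}, #|S| = n - k &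
  #|inside S| * (n * n.-1 * n.-2) <= #|F| * ((n - k) * (n - k).-1 * (n - k).-2).
Proof.
elim: k => [|k IH] kn.
  exists [set: 'I_n]; first by rewrite cardsT card_ord subn0.
  rewrite subn0 leq_mul2r; apply/orP; right.
  by rewrite subset_leq_card //; apply/subsetP => e; rewrite inE => /andP[].
have [S Sc Sb] := IH (ltnW kn).
have s0 : 0 < #|S| by rewrite Sc subn_gt0.
have [u uS ub] : exists2 u, u \in S & #|S| * #|inside (S :\ u)| <= (#|S| - 3) * #|inside S|.
  case: (boolP [exists u in S, #|S| * #|inside (S :\ u)| <= (#|S| - 3) * #|inside S|]).
    by move/exists_inP.
  rewrite negb_exists_in => /forall_inP h; exfalso.
  suff : #|S| * ((#|S| - 3) * #|inside S|).+1 <= #|S| * ((#|S| - 3) * #|inside S|).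
    by rewrite leq_pmul2l // ltnn.
  rewrite -{2}sum_inside_delete big_distrr /= -sum_nat_const.
  by apply: leq_sum => u uS; have := h u uS; rewrite -ltnNge.
exists (S :\ u); first by have := cardsD1 u S; rewrite uS Sc; lia.
rewrite -(leq_pmul2l s0).
have -> : n - k.+1 = #|S|.-1 by rewrite Sc; lia.
have -> : #|S|.-1.-2 = #|S| - 3 by lia.
rewrite mulnA; apply: leq_trans (leq_mul ub (leqnn _)) _.
rewrite -mulnA; apply: leq_trans (leq_mul (leqnn _) Sb) _.
rewrite -Sc; apply: eq_leq.
by move: (#|S| - 3) #|S|.-2 #|S|.-1 => a b c; lia.
Qed.

(** The complement of [S], together with one vertex of each edge inside [S], covers [F]. *)
Lemma tau_le_inside S : tau <= n - #|S| + #|inside S|.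
Proof.
pose f e := odflt ord0 [pick x in e].
have fP e : e \in F -> f e \in e.
  move=> /F3 e3; rewrite /f; case: pickP => //= x0.
  by move: e3; rewrite eq_card0.
apply: leq_trans (tau_min (C := ~: S :|: f @: inside S) _) _.
  apply/subsetP => e eF; apply/touchP.
  case: (boolP (e \subset S)) => [eS|/subsetPn[x xe xS]]; last by exists x; rewrite // !inE xS.
  by exists (f e); [exact: fP | rewrite inE imset_f ?orbT // inE eF].
apply: leq_trans (leq_card_setU _ _) _; apply: leq_add; last exact: leq_imset_card.
by have := cardsC S; rewrite card_ord; lia.
Qed.

Lemma large_tau_bound : 2 <= n' -> n <= 100 * tau -> n ^ 5 <= 1800 * (1800 * 1800) * Q ^ 6.
Proof.
move=> n2 nt; have tn := tau_le_n; have thr := threshold_bound; have mt := minterm_bound.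
set al := (n - tau) in thr.
have na : n * al.+1 <= 900 * (Q * Q).
  apply: (@leq_trans (100 * (al.+1 * tau))); first by rewrite [al.+1 * _]mulnC mulnA leq_mul.
  by apply: leq_trans (leq_mul (leqnn 100) thr) _; rewrite mulnA.
have Q0 : 0 < Q by rewrite muln_gt0 query_pos.
rewrite sixth_power; move: (Q * Q) mt na => q mt na.
case: (leqP (2 * al + 3) n) => [sn|ns].
  (* A set of size [2 * al + 3] must contain at least [al + 3] edges by [tau_le_inside]; for the
     sparsest such set this is the Turan bound, and the factor [al + 3] cancels. *)
  have [|S Sc Sb] := @sparse_subset (n - (2 * al + 3)); first exact: leq_subr.
  rewrite !subKn // in Sc Sb.
  have eS : al + 3 <= #|inside S| by have := tau_le_inside S; rewrite Sc /al; lia.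
  have main : n * n.-1 * n.-2 <= 8 * #|F| * (al.+1 * al.+1).
    rewrite -(@leq_pmul2l (al + 3)); last by lia.
    apply: leq_trans (leq_mul eS (leqnn _)) _; apply: leq_trans Sb _.
    apply: (@leq_trans (#|F| * ((2 * (al + 3)) * (2 * al.+1) * (2 * al.+1)))).
      by rewrite leq_mul2l; apply/orP; right; rewrite !leq_mul //; lia.
    by apply: eq_leq; lia.
  have n3 : n * (n * n) <= 36 * #|F| * (al.+1 * al.+1).
    have : 2 * (n * (n * n)) <= 9 * (n * n.-1 * n.-2).
      rewrite -[n * n.-1 * n.-2]mulnA mulnCA [9 * _]mulnCA leq_mul2l /=.
      by case: n' n2 => [|[|k]] //= _; exact: sqr_falling_le.
    by move/(leq_trans)/(_ (leq_mul (leqnn 9) main)); lia.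
  have -> : n ^ 5 = n * (n * n) * (n * n) by rewrite !expnS expn0; lia.
  apply: leq_trans (leq_mul n3 (leqnn _)) _.
  have -> : 36 * #|F| * (al.+1 * al.+1) * (n * n) = 36 * #|F| * ((n * al.+1) * (n * al.+1)) by lia.
  apply: leq_trans (leq_mul (leq_mul (leqnn 36) mt) (leq_mul na na)) _.
  rewrite (_ : 36 * q * _ = 36 * (900 * 900) * (q * (q * q))); last by lia.
  by rewrite leq_mul2r; apply/orP; right; rewrite !leq_mul.
(* In the remaining case [n] is at most [2 * al.+1], so the threshold bound alone is already
   quadratic in [n]. *)
have nn : n * n <= 1800 * q.
  apply: (@leq_trans (2 * (n * al.+1))); last by have := leq_mul (leqnn 2) na; lia.
  by rewrite mulnCA leq_mul2l; lia.
have -> : n ^ 5 = n * n * (n * n) * n by rewrite !expnS expn0; lia.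
apply: (@leq_trans (n * n * (n * n) * (n * n))).
  by apply: leq_mul => //; apply: leq_pmulr.
apply: leq_trans (leq_mul (leq_mul nn nn) nn) _.
by apply: eq_leq; move: 1800 => c; lia.
Qed.
End Fixed.
End Families.

(** * Extremal configurations of stars *)

Lemma half_bounds x : 2 * x./2 <= x /\ x <= 2 * x./2 + 1.
Proof. by have := odd_double_half x; rewrite -addnn; case: odd; lia. Qed.

Lemma half_le x : x./2 <= x.
Proof. by rewrite -{2}(odd_double_half x) -addnn addnA leq_addl. Qed.

(** Here [m <= 2 * (x - k)], [m <= 4 * (1 + (h - k))] and [m <= 2 * m.-1]. In the product of the
    three bounds [k * s] cancels, leaving 32 * 27 = 864. *)
Lemma fifth_power_few_centers m x k h s q :
  2 <= m -> m <= x -> x <= 2 * h + 1 -> 2 * k <= h -> 2 * h <= x -> 0 < k -> 0 < s ->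
  (x - k) * k <= q -> (1 + (h - k)) * s <= q -> m * (m.-1 * m.-1) <= 27 * (k * s) * q ->
  m ^ 5 <= 864 * (q * (q * q)).
Proof.
move=> m2 mx xh kh hx k0 s0 B1 B2 B3.
have ks0 : 0 < k * s by rewrite muln_gt0 k0.
rewrite -(leq_pmul2l ks0).
have m5 : m ^ 5 <= (2 * (x - k)) * (4 * (1 + (h - k))) * (4 * (m * (m.-1 * m.-1))).
  have -> : m ^ 5 = m * m * (m * (m * m)) by rewrite !expnS expn0; lia.
  have -> : 4 * (m * (m.-1 * m.-1)) = m * ((2 * m.-1) * (2 * m.-1)) by lia.
  by rewrite !leq_mul //; lia.
apply: leq_trans (leq_mul (leqnn _) m5) _.
have -> : k * s * (2 * (x - k) * (4 * (1 + (h - k))) * (4 * (m * (m.-1 * m.-1)))) =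
  32 * (((x - k) * k) * ((1 + (h - k)) * s) * (m * (m.-1 * m.-1))) by lia.
apply: (@leq_trans (32 * (q * q * (27 * (k * s) * q)))).
  by apply: leq_mul => //; apply: leq_mul => //; apply: leq_mul.
by apply: eq_leq; lia.
Qed.

(** When [k] exceeds [h / 2], both [x - k] and [k] are linear in [m], so the first bound
    suffices. *)
Lemma fifth_power_many_centers m x k h q :
  2 <= m -> m <= x -> x <= 2 * h + 1 -> h < 2 * k -> k <= h -> 2 * h <= x ->
  (x - k) * k <= q -> m ^ 5 <= 864 * (q * (q * q)).
Proof.
move=> m2 mx xh hk kh hx B1.
have mm : m * m <= 8 * q.
  apply: (@leq_trans ((2 * (x - k)) * (4 * k))); first by rewrite leq_mul //; lia.
  by rewrite mulnACA leq_mul.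
apply: (@leq_trans (m * m * (m * m) * (m * m))).
  rewrite (_ : m ^ 5 = m * m * (m * m) * m); last by rewrite !expnS expn0; lia.
  by rewrite leq_mul // leq_pmulr //; lia.
apply: leq_trans (leq_mul (leq_mul mm mm) mm) _.
by rewrite (_ : 8 * q * (8 * q) * (8 * q) = 512 * (q * (q * q))) ?leq_mul //; lia.
Qed.

Lemma card_dpair (A B : finType) (P : {set A}) (R : A -> {set B}) :
  #|[set z : A * B | (z.1 \in P) && (z.2 \in R z.1)]| = \sum_(a in P) #|R a|.
Proof.
under [RHS]eq_bigr => a _ do rewrite -sum1_card.
by rewrite pair_big_dep -sum1_card; apply: eq_bigl => z; rewrite inE.
Qed.

Section Stars.
Variable n' : nat.
Notation n := n'.+1.
Notation hyp := {set {set 'I_n}}.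
Notation cfg := {ffun 'I_n -> {set {set 'I_n}}}.
Variables (T : nat) (F : hyp).
Hypothesis F3 : forall e : {set 'I_n}, e \in F -> #|e| = 3.
Hypothesis adv : adversary_bounded T F.
Notation emb := (embeds F).
Notation Q := (36 * T).

(** The base hypergraph [b] is symmetric under permutations that keep the colour of every vertex.
    Centres come from the single-coloured set [X]; links are graphs on [Y], whose vertices may have
    several colours, each with a class of size at least [m]. *)
Variables (col : 'I_n -> nat) (X Y : {set 'I_n}) (b : hyp) (m : nat).
Hypothesis col_X : {in X &, forall x y, col x = col y}.
Hypothesis col_XY : forall x y, x \in X -> y \in Y -> col x != col y.
Hypothesis b_inv : forall (s : 'S_n) (e : {set 'I_n}),
  (forall i, col (s i) = col i) -> (s @: e \in b) = (e \in b).
Hypothesis X_large : m <= #|X|.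
Hypothesis Y_large : forall y, y \in Y -> m <= #|[set i | col i == col y]|.

Implicit Types (g : cfg) (e w : {set 'I_n}).

Definition pairs : hyp := [set w : {set 'I_n} | (w \subset Y) && (#|w| == 2)].
Definition full_stars (X0 : {set 'I_n}) : hyp :=
  [set e : {set 'I_n} | [exists x in X0, (x \in e) && (e :\ x \in pairs)]].
Definition valid g := [forall x, (g x \subset pairs) && ((x \in X) || (g x == set0))].
Definition supp g := [set x | g x != set0].
Definition stars g : hyp := [set e : {set 'I_n} | [exists x in X, (x \in e) && (e :\ x \in g x)]].
Notation G g := (b :|: stars g).

Lemma starsP g e :
  reflect (exists2 x, x \in X & (x \in e) && (e :\ x \in g x)) (e \in stars g).
Proof. by rewrite inE; apply: exists_inP. Qed.

Lemma notin_XY x : x \in X -> x \in Y -> False.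
Proof. by move=> xX xY; have := col_XY xX xY; rewrite eqxx. Qed.

Lemma valid_pairs g x w : valid g -> w \in g x -> w \in pairs.
Proof. by move=> /forallP /(_ x) /andP[/subsetP + _]; apply. Qed.

Lemma valid_supp g : valid g -> supp g \subset X.
Proof.
move=> gv; apply/subsetP => x; rewrite inE => gx.
by move/forallP: gv => /(_ x) /andP[_]; rewrite (negbTE gx) orbF.
Qed.

(** A star edge has just one vertex in [X], so an input bit determines its centre. Every load
    estimate for single bits below rests on this. *)
Lemma center_uniq e x y : e :\ x \in pairs -> y \in e -> y \in X -> y = x.
Proof.
rewrite inE => /andP[/subsetP sub _] ye yX; apply/eqP; apply/negPn/negP => yx.
by apply: (@notin_XY y) => //; apply: sub; rewrite !inE yx.
Qed.

Lemma stars_diff g g' e : (e \in G g) != (e \in G g') ->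
  exists x, [/\ x \in X, x \in e & (e :\ x \in g x) != (e :\ x \in g' x)].
Proof.
move=> ne; case: (pickP [pred x | [&& x \in X, x \in e & (e :\ x \in g x) != (e :\ x \in g' x)]]).
  by move=> x /and3P[]; exists x.
move=> h; case/negP: ne; rewrite !in_setU; apply/eqP; congr (_ || _); rewrite !inE.
apply: eq_existsb => x; case: (boolP (x \in X)) => //= xX.
by case: (boolP (x \in e)) => //= xe; have := h x; rewrite /= xX xe /= => /negbFE/eqP.
Qed.

Definition swap p q g : cfg := [ffun x => g (tperm p q x)].

Lemma col_tperm p q : col p = col q -> forall i, col (tperm p q i) = col i.
Proof. by move=> pq i; case: tpermP => [->|->|]. Qed.

Lemma tperm_fix_pairs p q w : p \in X -> q \in X -> w \in pairs -> tperm p q @: w = w.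
Proof.
move=> pX qX; rewrite inE => /andP[/subsetP wY _].
rewrite -[RHS]imset_id; apply: eq_in_imset => i /wY iY; rewrite tpermD //.
  by apply/eqP => pi; rewrite pi in pX; case: (notin_XY pX iY).
by apply/eqP => qi; rewrite qi in qX; case: (notin_XY qX iY).
Qed.

(** A transposition inside [X] fixes [b] and every pair in [Y], so it merely exchanges two links. *)
Lemma conj_stars p q g : p \in X -> q \in X -> valid g ->
  conj_hyp (tperm p q) (G g) = G (swap p q g).
Proof.
move=> pX qX gv; set s := tperm p q.
have sV : (s^-1)%g = s by rewrite tpermV.
have sK : involutive s by apply: tpermK.
have sX x : (s x \in X) = (x \in X).
  by rewrite /s; case: tpermP => [->|->|]; rewrite ?pX ?qX.
have sD e x : s @: e :\ s x = s @: (e :\ x).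
  have s_inj := @perm_inj _ s; apply/setP => y.
  by rewrite -[y]sK !inE !(mem_imset _ _ s_inj) !inE (inj_eq s_inj).
apply/setP => e; rewrite inE sV !in_setU b_inv; last by apply: col_tperm; apply: col_X.
congr (_ || _); apply/starsP/starsP => -[x xX /andP[xe ex]].
  move: xe ex xX => /imsetP[y ye ->]; rewrite sD sX => ex yX; exists y => //; rewrite ye ffunE -/s.
  have := tperm_fix_pairs pX qX (valid_pairs gv ex); rewrite -/s -perm_imsetM tperm2 perm_imset1.
  by move=> ->.
rewrite ffunE -/s in ex; exists (s x); rewrite ?sX // imset_f //= sD.
by rewrite (tperm_fix_pairs pX qX (valid_pairs gv ex)).
Qed.

(** With base [n + 1], even [n] links of size [s - 1] weigh less than one link of size [s]: lowering
    one link pays for raising any number of smaller ones to just below its old level. *)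
Definition pot g := \sum_(x in supp g) n.+1 ^ #|g x|.

Lemma potE g : pot g = \sum_x (if g x == set0 then 0 else n.+1 ^ #|g x|).
Proof. by rewrite /pot big_mkcond; apply: eq_bigr => x _; rewrite inE; case: eqP. Qed.

Section Extremal.
Variables (g : cfg) (h : nat).
Hypotheses (g_valid : valid g) (g_supp : #|supp g| <= h) (g_emb : emb (G g)).
Hypothesis g_min : forall g', valid g' -> #|supp g'| <= h -> pot g' < pot g -> ~~ emb (G g').
Notation k := #|supp g|.
Notation Z := (X :\: supp g).

Lemma Z_empty q : q \in Z -> q \in X /\ g q = set0.
Proof. by rewrite !inE negbK => /andP[/eqP -> ->]. Qed.

Definition drop_center p : cfg := [ffun x => if x == p then set0 else g x].

Lemma drop_center_not_emb p : p \in supp g -> ~~ emb (G (drop_center p)).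
Proof.
move=> ps; apply: g_min.
- apply/forallP => x; rewrite ffunE; case: eqP => _; first by rewrite sub0set eqxx orbT.
  by move/forallP: g_valid.
- apply: leq_trans g_supp; rewrite subset_leq_card //; apply/subsetP => x.
  by rewrite !inE ffunE; case: (x == p); rewrite ?eqxx.
rewrite !potE (bigD1 p) //= [X in _ < X](bigD1 p) //= ffunE !eqxx add0n.
move: ps; rewrite inE => /negbTE ->.
rewrite -[X in X < _]add0n -addSn leq_add ?expn_gt0 //.
by apply: leq_sum => x /negbTE xp; rewrite ffunE xp.
Qed.

(** Up to a relabelling [s], the configuration with the star at [p] dropped is paired with the one
    whose star is moved from [p] to the empty centre [q]. At a rejected input a bit determines [q],
    one choice among [#|Z|]; at an accepted input it determines [p], one among [k]. *)
Lemma center_swap_bound : #|Z| * k <= Q * Q.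
Proof.
case: (posnP #|Z|) => [->//|Z0]; case: (posnP k) => [->|k0]; first by rewrite muln0.
have sX := subsetP (valid_supp g_valid).
pose D := [set z : 'S_n * 'I_n * 'I_n | (z.1.2 \in supp g) && (z.2 \in Z)].
pose l0 (z : 'S_n * 'I_n * 'I_n) := z.1.
(* Moving the star gives an isomorphic copy of [G g], so one permutation labels the accepted input
   while [p] and [q] stay free. *)
pose l1 (z : 'S_n * 'I_n * 'I_n) := (tperm z.1.2 z.2 * z.1.1)%g.
pose IX (y : 'S_n * 'I_n) := conj_hyp y.1 (G (drop_center y.2)).
pose IY (s : 'S_n) := conj_hyp s (G g).
have IYE s p q e : p \in supp g -> q \in Z ->
    (e \in IY (tperm p q * s)%g) = ((s^-1)%g @: e \in G (swap p q g)).
  by move=> /sX pX /Z_empty[qX _]; rewrite /IY conj_hypM conj_stars // in_conj_hyp.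
(* Once [p] is dropped both links at [p] and [q] are empty, so the transposition fixes the rejected
   input. *)
have IXE s p q e : p \in supp g -> q \in Z ->
    (e \in IX ((tperm p q * s)%g, p)) = ((s^-1)%g @: e \in G (drop_center p)).
  move=> /sX pX qZ; have [qX q0] := Z_empty qZ; rewrite /IX /= conj_hypM conj_stars //.
    rewrite in_conj_hyp; congr (_ \in _ :|: stars _); apply/ffunP => x; rewrite !ffunE.
    case: tpermP => [->|->|//]; last by rewrite eqxx; case: eqP.
    by rewrite eqxx q0; case: eqP.
  apply/forallP => x; rewrite ffunE; case: eqP => _; first by rewrite sub0set eqxx orbT.
  by move/forallP: g_valid.
have swap_diff e p q : p \in supp g -> q \in Z ->
    (e \in G (drop_center p)) != (e \in G (swap p q g)) ->
    [/\ q \in X, q \in e & e :\ q \in pairs].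
  move=> ps qZ /stars_diff[x [xX xe]]; have [qX q0] := Z_empty qZ; rewrite !ffunE.
  case: tpermP => [->|xq|/eqP/negbTE -> _]; last by rewrite eqxx.
    by rewrite eqxx q0 !inE.
  rewrite xq in xe *.
  have -> : (if q == p then set0 else g q) = set0 by rewrite q0; case: ifP.
  by rewrite inE => ne; split=> //; apply: (valid_pairs g_valid (x := p)); case: (_ \in g p) ne.
have drop_diff e p : (e \in G (drop_center p)) != (e \in G g) ->
    [/\ p \in X, p \in e & e :\ p \in pairs].
  move=> /stars_diff[x [xX xe]]; rewrite ffunE; case: (eqVneq x p) => [xp|_]; last by rewrite eqxx.
  subst x; rewrite inE => ne; split=> //.
  by apply: (valid_pairs g_valid (x := p)); case: (_ \in g p) ne.
have inD s p q : ((s, p, q) \in D) = (p \in supp g) && (q \in Z) by rewrite inE.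
rewrite -[X in _ <= X]mul1n -[X in _ <= X * _]muln1.
apply: (@adversary_boundedQ _ _ _ adv _ _ _ D l0 l1 IX IY) => //.
- have [p ps] := card_gt0P k0; have [q qZ] := card_gt0P Z0.
  by apply/card_gt0P; exists (1%g, p, q); rewrite inD ps.
- move=> [[s p] q]; rewrite inD => /andP[ps _].
  by rewrite /IX /= embeds_conj; apply: drop_center_not_emb.
- by move=> [[s p] q] _; rewrite /IY embeds_conj.
- move=> e [s p] e3; rewrite mul1n; set A := [set z in D | _ & _]; set B := [set z in D | _].
  have AP s1 p1 q1 : (s1, p1, q1) \in A -> [/\ s1 = s, p1 = p, p \in supp g, q1 \in Z &
     [/\ q1 \in X, q1 \in (s^-1)%g @: e & ((s^-1)%g @: e) :\ q1 \in pairs]].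
    rewrite inE inD => /andP[/andP[ps qZ] /andP[/eqP[-> ep]]]; rewrite /l0 /l1 /= in ps ep *.
    rewrite ep in ps *; rewrite IYE // /IX in_conj_hyp => ne; split=> //.
    exact: (swap_diff _ _ _ ps qZ ne).
  case: (set_0Vmem A) => [->|[[[s1 p1] q1] /AP[_ _ ps _ _]]]; first by rewrite cards0 muln0.
  apply: (@leq_trans (#|Z| * 1)); last first.
    rewrite muln1 -(@card_imset _ _ (fun q => (s, p, q))); last by move=> ? ? [].
    rewrite subset_leq_card //; apply/subsetP => _ /imsetP[q qZ ->].
    by rewrite inE inD ps qZ /l0 eqxx.
  rewrite leq_mul2l; apply/orP; right; apply/card_le1_eqP => -[[s2 p2] q2] [[s3 p3] q3].
  move=> /AP[-> -> _ _ [q2X q2e _]] /AP[-> -> _ _ [_ _ q3P]].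
  by rewrite (center_uniq q3P q2e q2X).
move=> e r e3; rewrite mul1n; set A := [set z in D | _ & _]; set B := [set z in D | _].
have AP s1 p1 q1 : (s1, p1, q1) \in A -> [/\ s1 = (tperm p1 q1 * r)%g, p1 \in supp g, q1 \in Z &
   [/\ p1 \in X, p1 \in (r^-1)%g @: e & ((r^-1)%g @: e) :\ p1 \in pairs]].
  rewrite inE inD => /andP[/andP[ps qZ] /andP[/eqP er]]; rewrite /l0 /l1 /= in er *.
  have es : s1 = (tperm p1 q1 * r)%g by rewrite -er mulgA tperm2 mul1g.
  rewrite er es IXE // in_conj_hyp => ne; split=> //; exact: (drop_diff _ _ ne).
case: (set_0Vmem A) => [->|[[[s1 p1] q1] /AP[_ p1s q1Z [p1X p1e p1P]]]]; first by rewrite cards0 muln0.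
apply: (@leq_trans (k * #|Z|)).
  rewrite leq_mul2l; apply/orP; right.
  apply: leq_trans (leq_imset_card (fun q => ((tperm p1 q * r)%g, p1, q)) Z).
  rewrite subset_leq_card //; apply/subsetP => -[[s2 p2] q2] /AP[-> _ q2Z [p2X p2e _]].
  by rewrite (center_uniq p1P p2e p2X); apply/imsetP; exists q2.
rewrite -cardsX -(@card_imset _ _ (fun z => ((tperm z.1 z.2 * r)%g, z.1, z.2))); last first.
  by move=> [? ?] [? ?] [_ -> ->].
rewrite subset_leq_card //; apply/subsetP => _ /imsetP[[p q] + ->].
rewrite in_setX => /andP[/= ps qZ].
by rewrite inE inD ps qZ /l1 /= mulgA tperm2 mul1g eqxx.
Qed.

Section Lowering.
Variables (v : 'I_n) (J : {set 'I_n}).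
Hypotheses (v_supp : v \in supp g) (J_Z : J \subset Z) (J_card : #|J| + k <= h).
Notation Jv := (v |: J).
Notation fam := {ffun 'I_n -> {set 'I_n}}.
Implicit Types u : fam.

(** Every centre in [Jv] receives the link of [v] with one pair missing, the pair being chosen by
    [u] separately at each centre. *)
Definition lowered u : cfg := [ffun x => if x \in Jv then g v :\ u x else g x].
(* [set0] is not a pair, so erasing [u] at [x] restores the whole link [g v] there. *)
Definition erase u x : fam := [ffun y => if y == x then set0 else u y].
Definition good u := [forall x in Jv, u x \in g v].

Lemma Jv_X : Jv \subset X.
Proof.
have sX := subsetP (valid_supp g_valid).
rewrite subUset sub1set sX //=; apply/subsetP => x /(subsetP J_Z).
by rewrite inE => /andP[].
Qed.

Lemma valid_lowered u : valid (lowered u).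
Proof.
apply/forallP => x; rewrite ffunE; case: ifP => [xJ|_]; last by move/forallP: g_valid.
rewrite (subsetP Jv_X _ xJ) andbT; apply/subsetP => w.
by rewrite in_setD1 => /andP[_]; apply: valid_pairs.
Qed.

(** The potential drops: [Jv] has at most [n] centres, each now carrying a link one smaller than
    [g v], and [J_card] keeps the number of centres within [h]. *)
Lemma lowered_not_emb u : good u -> ~~ emb (G (lowered u)).
Proof.
move=> /forall_inP ug; apply: g_min; first exact: valid_lowered.
  apply: leq_trans J_card; rewrite addnC; apply: leq_trans (leq_card_setU _ _).
  rewrite subset_leq_card //; apply/subsetP => x; rewrite in_setU [x \in supp _]inE ffunE.
  case: ifP => [|_ gx]; last by rewrite inE gx.
  by rewrite in_setU1 => /orP[/eqP ->|->] //; rewrite ?v_supp ?orbT.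
have s0 : 0 < #|g v| by rewrite card_gt0; move: v_supp; rewrite inE.
rewrite !potE (bigID (mem Jv)) /= [X in _ < X](bigID (mem Jv)) /=.
rewrite -addSn leq_add //; last first.
  by apply: leq_sum => x /negbTE xJ; rewrite ffunE xJ.
apply: (@leq_trans (n.+1 ^ #|g v|)); last first.
  by rewrite (bigD1 v) ?setU11 //=; move: v_supp; rewrite inE => /negbTE ->; apply: leq_addr.
rewrite -(prednK s0) expnS mulSn.
apply: (@leq_ltn_trans (n * n.+1 ^ #|g v|.-1)); last by rewrite -addn1 addnC leq_add2r expn_gt0.
apply: (@leq_trans (#|Jv| * n.+1 ^ #|g v|.-1)); last first.
  by rewrite leq_mul2r; apply/orP; right; have := max_card (mem Jv); rewrite card_ord.
rewrite -sum_nat_const; apply: leq_sum => x xJ; rewrite ffunE xJ; case: ifP => // _.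
by have := cardsD1 (u x) (g v); rewrite ug // => ->.
Qed.

(** With the full link [g v] present at [x], the configuration contains the image of [g] under the
    transposition of [v] and [x]. *)
Lemma erased_emb u x : x \in Jv -> emb (G (lowered (erase u x))).
Proof.
move=> xJ; have xX := subsetP Jv_X _ xJ; have vX : v \in X by apply: (subsetP Jv_X); rewrite setU11.
have : emb (conj_hyp (tperm v x) (G g)) by rewrite embeds_conj.
apply: embeds_mono => // e _; rewrite conj_stars // !in_setU.
case: (e \in b) => //= /starsP[y yX /andP[ye]]; rewrite ffunE => ey.
apply/starsP; exists y => //; rewrite ye /= ffunE.
have wne w : w \in g v -> w \in g v :\ set0.
  move=> wv; rewrite in_setD1 wv andbT; apply/eqP => w0.
  by have := valid_pairs g_valid wv; rewrite w0 inE cards0 andbF.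
move: ey; case: tpermP => [->|->|/eqP yv /eqP yx]; last 1 first.
- case: ifP => // yJ; suff -> : g y = set0 by rewrite inE.
  move: yJ; rewrite in_setU1 (negbTE yv) /= => /(subsetP J_Z) /Z_empty[].
  by [].
- case: (eqVneq x v) => [->|xv].
    by rewrite setU11 ffunE eqxx; apply: wne.
  move: xJ; rewrite in_setU1 (negbTE xv) /= => /(subsetP J_Z) /Z_empty[_ ->].
  by rewrite inE.
by rewrite xJ ffunE eqxx; apply: wne.
Qed.

(** The pairs restore the missing pair at one centre [x] of [Jv]. At a rejected input a bit
    determines [x], one of [#|Jv|]; at an accepted input [x] is known and the bit determines the
    missing pair, one of [#|g v|]. *)
Lemma lowering_bound : #|Jv| * #|g v| <= Q * Q.
Proof.
have s0 : 0 < #|g v| by rewrite card_gt0; move: v_supp; rewrite inE.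
pose D := [set z : fam * 'I_n | good z.1 && (z.2 \in Jv)].
pose l0 (z : fam * 'I_n) := z.1.
pose l1 (z : fam * 'I_n) := (erase z.1 z.2, z.2).
pose IX u := G (lowered u).
pose IY (z : fam * 'I_n) := G (lowered z.1).
have inD u x : ((u, x) \in D) = good u && (x \in Jv) by rewrite inE.
have diff u x e : good u -> x \in Jv -> (e \in IX u) != (e \in IY (erase u x, x)) ->
    [/\ x \in X, x \in e, e :\ x \in pairs & e :\ x = u x].
  move=> ug xJ /stars_diff[y [yX ye]]; rewrite !ffunE.
  case: (eqVneq y x) => [yx|_]; last by rewrite eqxx.
  subst y; rewrite xJ !in_setD1; case: (boolP (e :\ x \in g v)) => [ev|]; last by rewrite !andbF.
  have eP := valid_pairs g_valid ev; rewrite !andbT => ne; split=> //.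
  apply/eqP; apply: contraR ne => ->; rewrite eq_sym eqb_id.
  by apply/eqP => e0; move: eP; rewrite e0 inE cards0 andbF.
rewrite -[X in _ <= X]mul1n -[X in _ <= X * _]muln1.
apply: (@adversary_boundedQ _ _ _ adv _ _ _ D l0 l1 IX IY) => //.
- have [w wv] := card_gt0P s0.
  apply/card_gt0P; exists ([ffun=> w], v); rewrite inD setU11 andbT.
  by apply/forall_inP => x _; rewrite ffunE.
- by move=> [u x]; rewrite inD => /andP[ug _]; apply: lowered_not_emb.
- by move=> [u x]; rewrite inD => /andP[_ xJ]; apply: erased_emb.
- move=> e u e3; rewrite mul1n; set A := [set z in D | _ & _]; set B := [set z in D | _].
  have AP u1 x1 : (u1, x1) \in A ->
      [/\ u1 = u, good u, x1 \in X, x1 \in e & e :\ x1 \in pairs].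
    rewrite inE inD => /andP[/andP[ug xJ] /andP[/eqP eu]]; rewrite /l0 /l1 /= in eu *.
    by case/(diff _ _ _ ug xJ) => ? ? ? _; rewrite -eu.
  case: (set_0Vmem A) => [->|[[u1 x1] /AP[_ ug _ _ _]]]; first by rewrite cards0 muln0.
  apply: (@leq_trans (#|Jv| * 1)); last first.
    rewrite muln1 -(@card_imset _ _ (fun x => (u, x))); last by move=> ? ? [].
    rewrite subset_leq_card //; apply/subsetP => _ /imsetP[x xJ ->].
    by rewrite inE inD ug xJ /l0 eqxx.
  rewrite leq_mul2l; apply/orP; right; apply/card_le1_eqP => -[u2 x2] [u3 x3].
  move=> /AP[-> _ x2X x2e _] /AP[-> _ _ _ x3P].
  by rewrite (center_uniq x3P x2e x2X).
move=> e [u' x'] e3; rewrite mul1n; set A := [set z in D | _ & _]; set B := [set z in D | _].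
have AP u1 x1 : (u1, x1) \in A -> [/\ x1 = x', x' \in Jv, good u1,
    (forall y, y != x' -> u1 y = u' y) & u1 x' = e :\ x' /\ u' x' = set0].
  rewrite inE inD => /andP[/andP[ug xJ] /andP[/eqP[eu ex]]]; rewrite /l0 /l1 /= in eu ex *.
  case/(diff _ _ _ ug xJ) => _ _ _ ee; rewrite ex in ee xJ; split=> // [y yx|].
    by rewrite -eu ffunE ex (negbTE yx).
  by rewrite ee -eu ffunE ex eqxx.
case: (set_0Vmem A) => [->|[[u1 x1] /AP[_ xJ ug ou [_ u'x]]]]; first by rewrite cards0 muln0.
apply: (@leq_trans (#|g v| * 1)).
  rewrite leq_mul2l; apply/orP; right; apply/card_le1_eqP => -[u2 x2] [u3 x3].
  move=> /AP[-> _ _ o2 [e2 _]] /AP[-> _ _ o3 [e3' _]]; congr (_, _); apply/ffunP => y.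
  by case: (eqVneq y x') => [->|yx]; [rewrite e2 e3' | rewrite o2 ?o3].
rewrite muln1 -(@card_imset _ _ (fun w => ([ffun y => if y == x' then w else u' y] : fam, x'))).
  rewrite subset_leq_card //; apply/subsetP => _ /imsetP[w wv ->].
  rewrite inE inD xJ andbT; apply/andP; split.
    apply/forall_inP => y yJ; rewrite ffunE; case: (eqVneq y x') => // yx.
    by rewrite -ou //; move/forall_inP: ug; apply.
  rewrite /l1 /=; apply/eqP; congr (_, _); apply/ffunP => y; rewrite !ffunE.
  by case: (eqVneq y x') => [->|] //; rewrite u'x.
by move=> w1 w2 [/ffunP/(_ x')]; rewrite !ffunE eqxx.
Qed.
End Lowering.

Definition colored_perms := [set s : 'S_n | [forall i, col (s i) == col i]].

Lemma colored_permsP (s : 'S_n) : reflect (forall i, col (s i) = col i) (s \in colored_perms).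
Proof. by rewrite inE; apply: (iffP forallP) => h' i; apply/eqP. Qed.

Lemma colored_permsM (s t : 'S_n) :
  s \in colored_perms -> t \in colored_perms -> (s * t)%g \in colored_perms.
Proof.
by move=> /colored_permsP sc /colored_permsP tc; apply/colored_permsP => i; rewrite permM tc.
Qed.

Lemma colored_permsV (s : 'S_n) : s \in colored_perms -> (s^-1)%g \in colored_perms.
Proof.
by move=> /colored_permsP sc; apply/colored_permsP => i; rewrite -{2}(permKV s i) sc.
Qed.

Lemma colored_perms_gt0 : 0 < #|colored_perms|.
Proof. by apply/card_gt0P; exists 1%g; apply/colored_permsP => i; rewrite perm1. Qed.

(** The vertices [x], [a], [c] of [e'] can be moved to at least [m * (m.-1 * m.-1)] triples of the
    same colours. Composing with such moves gives distinct pairs of a coloured permutation and a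
    target triple, and the target coordinates lie in a 3-element set: at most 27 per permutation. *)
Lemma card_fixed_image e e' : #|e| = 3 -> e' \in stars g ->
  (m * (m.-1 * m.-1)) * #|[set s in colored_perms | (s^-1)%g @: e == e']| <=
  27 * #|colored_perms|.
Proof.
move=> e3 /starsP[x xX /andP[xe' ex]]; have := valid_pairs g_valid ex.
rewrite inE => /andP[/subsetP exY /cards2P[a [c [ac eac]]]].
have [aY cY] : a \in Y /\ c \in Y by split; apply: exY; rewrite eac !inE eqxx ?orbT.
have [ae' ce'] : a \in e' /\ c \in e'.
  by split; apply: (subsetP (subsetDl e' [set x])); rewrite eac !inE eqxx ?orbT.
set C := [set s in _ | _].
pose cls y := [set i | col i == col y].
(* The target of [a] avoids [c] and the target of [c] avoids that of [a], so the three
   transpositions in [rho] do not disturb each other's targets; each exclusion costs one vertex. *)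
pose P2 := [set z : 'I_n * 'I_n | (z.1 \in cls a :\ c) && (z.2 \in cls c :\ z.1)].
have card_cls y i : y \in Y -> m.-1 <= #|cls y :\ i|.
  move=> yY; rewrite -subn1 leq_subLR; apply: leq_trans (Y_large yY) _.
  by rewrite -/(cls y) (cardsD1 i) leq_add2r leq_b1.
have P2c : m.-1 * m.-1 <= #|P2|.
  rewrite /P2 (card_dpair (cls a :\ c) (fun i => cls c :\ i)).
  apply: (@leq_trans (\sum_(i in cls a :\ c) m.-1)).
    by rewrite sum_nat_const leq_mul2r card_cls ?orbT.
  by apply: leq_sum => i _; apply: card_cls.
apply: (@leq_trans (#|setX (setX X P2) C|)).
  by rewrite !cardsX leq_mul // leq_mul.
pose rho (t : 'I_n * ('I_n * 'I_n)) : 'S_n :=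
  (tperm x t.1 * tperm a t.2.1 * tperm c t.2.2)%g.
have XYne i j j' : i \in X -> j' \in Y -> col j = col j' -> (i == j) = false.
  by move=> iX jY cj; apply/eqP => ij; have := col_XY iX jY; rewrite ij cj eqxx.
have rhoP t : t \in setX X P2 ->
    [/\ rho t \in colored_perms, rho t x = t.1, rho t a = t.2.1 & rho t c = t.2.2].
  case: t => x2 [a2 c2] tX; rewrite !inE /= in tX.
  case/andP: tX => x2X /andP[/andP[a2c /eqP ca] /andP[c2a2 /eqP cc]].
  have x2a2 : a2 != x2 by rewrite eq_sym (XYne _ _ a).
  have x2c2 : c2 != x2 by rewrite eq_sym (XYne _ _ c).
  have x2a : x2 != a by rewrite (XYne _ _ a).
  have x2c : x2 != c by rewrite (XYne _ _ c).
  have xa : x != a by rewrite (XYne _ _ a).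
  have xc : x != c by rewrite (XYne _ _ c).
  rewrite /rho /=; split.
  - by do 2?apply: colored_permsM; apply/colored_permsP; apply: col_tperm => //; apply: col_X.
  - by rewrite !permM tpermL [tperm a _ _]tpermD 1?[a == _]eq_sym // tpermD // eq_sym.
  - by rewrite !permM [tperm x _ _]tpermD // tpermL tpermD // eq_sym.
  by rewrite !permM [tperm x _ _]tpermD // [tperm a _ _]tpermD // tpermL.
pose f (z : ('I_n * ('I_n * 'I_n)) * 'S_n) := (((rho z.1)^-1 * z.2)%g, z.1).
rewrite -(@card_imset _ _ f); last first.
  by move=> [t1 s1] [t2 s2] [+ et]; rewrite et => /mulgI ->.
pose R (s : 'S_n) := let A := (s^-1)%g @: e in setX A (setX A A).
apply: (@leq_trans #|[set z | (z.1 \in colored_perms) && (z.2 \in R z.1)]|).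
  rewrite subset_leq_card //; apply/subsetP => _ /imsetP[[t s] + ->].
  rewrite in_setX => /andP[/rhoP[rc rx ra rb] sC].
  have /andP[sc /eqP se] : (s \in colored_perms) && ((s^-1)%g @: e == e').
    by move: sC; rewrite inE.
  rewrite inE /f /= colored_permsM ?colored_permsV //= /R invMg invgK perm_imsetM se.
  move: rx ra rb {rc}; move: (rho t) => r; case: t {sC} => x2 [a2 c2] /= <- <- <-.
  by rewrite !in_setX /= !imset_f.
rewrite card_dpair mulnC -sum_nat_const; apply: leq_sum => s _.
by rewrite /R !cardsX !card_perm_imset e3.
Qed.

Variable s : nat.
Hypothesis s_max : forall x, #|g x| <= s.

Lemma card_stars : #|stars g| <= k * s.
Proof.
apply: (@leq_trans #|[set z : 'I_n * {set 'I_n} | (z.1 \in supp g) && (z.2 \in g z.1)]|).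
  apply: leq_trans (leq_imset_card (fun z => z.1 |: z.2) _).
  rewrite subset_leq_card //; apply/subsetP => e /starsP[x xX /andP[xe ex]].
  apply/imsetP; exists (x, e :\ x); rewrite ?setD1K // !inE /= ex andbT.
  by apply/set0Pn; exists (e :\ x).
by rewrite card_dpair -sum_nat_const; apply: leq_sum.
Qed.

(** The single rejected input [b] is paired with all coloured copies of [G g]. As [b] is invariant,
    a bit separates a copy only if it pulls back to one of at most [k * s] star edges, and
    [card_fixed_image] bounds the copies for each. *)
Lemma packing_bound : ~~ emb b -> 0 < k -> 0 < s ->
  m * (m.-1 * m.-1) <= 27 * (k * s) * (Q * Q).
Proof.
move=> b0 k0 s0; pose IY (t : 'S_n) := conj_hyp t (G g).
rewrite -[X in X <= _]muln1 -[27 * _]muln1.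
apply: (@adversary_boundedQ _ _ _ adv _ _ _ colored_perms (fun=> tt) id (fun=> b) IY) => //.
- exact: colored_perms_gt0.
- by move=> t _; rewrite /IY embeds_conj.
- move=> e [] e3; set A := [set z in _ | _ & _].
  have -> : [set z in colored_perms | tt == tt] = colored_perms.
    by apply/setP => t; rewrite inE andbT.
  pose C e' := [set t in colored_perms | (t^-1)%g @: e == e'].
  have leA : #|A| <= \sum_(e' in stars g) #|C e'|.
    rewrite -card_dpair; apply: leq_trans (leq_imset_card snd _).
    rewrite subset_leq_card //; apply/subsetP => t; rewrite inE => /andP[tc /andP[_]].
    rewrite /IY in_conj_hyp in_setU b_inv; last by apply/colored_permsP; apply: colored_permsV.
    case: (e \in b) => //= es; apply/imsetP; exists ((t^-1)%g @: e, t) => //.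
    by rewrite inE /= (negbNE es) inE tc eqxx.
  apply: leq_trans (leq_mul (leqnn _) leA) _; rewrite big_distrr /=.
  apply: (@leq_trans (\sum_(e' in stars g) 27 * #|colored_perms|)).
    by apply: leq_sum => e' e's; apply: card_fixed_image.
  rewrite sum_nat_const mulnA [_ * 27]mulnC leq_mul2r; apply/orP; right.
  by rewrite leq_mul2l card_stars.
- move=> e t e3; rewrite !mul1n subset_leq_card //; apply/subsetP => t'.
  by rewrite !inE => /and3P[-> -> _].
by rewrite !muln_gt0 k0 s0.
Qed.
End Extremal.

Theorem star_bound (X0 : {set 'I_n}) : 2 <= m -> X0 \subset X -> #|X0| <= #|X|./2 ->
  ~~ emb b ->
  emb (b :|: full_stars X0) ->
  m ^ 5 <= 864 * Q ^ 6.
Proof.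
move=> m2 X0X X0h b0 full; pose h := #|X|./2.
pose g0 : cfg := [ffun x => if x \in X0 then pairs else set0].
pose P g := [&& valid g, #|supp g| <= h & emb (G g)].
have Pg0 : P g0.
  apply/and3P; split.
  - apply/forallP => x; rewrite ffunE; case: ifP => [/(subsetP X0X) ->|_]; rewrite ?subxx //.
    by rewrite sub0set eqxx orbT.
  - apply: leq_trans X0h; rewrite subset_leq_card //; apply/subsetP => x.
    by rewrite inE ffunE; case: ifP => //; rewrite eqxx.
  apply: embeds_mono full => // e _; rewrite !in_setU; case: (e \in b) => //=.
  rewrite inE => /exists_inP[x xX /andP[xe ex]]; apply/starsP; exists x; rewrite ?(subsetP X0X) //.
  by rewrite xe ffunE xX.
case: (arg_minnP pot Pg0) => g /and3P[gv gs ge] gmin.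
have g_min g' : valid g' -> #|supp g'| <= h -> pot g' < pot g -> ~~ emb (G g').
  move=> v' s' lt; apply/negP => e'; have := gmin g'; rewrite /P v' s' e' => /(_ isT).
  by rewrite leqNgt lt.
(* With no centre the accepted hypergraph would be [b] itself, which is rejected. *)
have k0 : 0 < #|supp g|.
  rewrite lt0n; apply: contraNneq b0 => /eqP; rewrite cards_eq0 => /eqP s0.
  apply: embeds_mono ge => // e _; rewrite in_setU => /orP[//|/starsP[x _ /andP[_ ex]]].
  by have : x \in supp g by [rewrite inE; apply/set0Pn; exists (e :\ x)]; rewrite s0 inE.
have [v0 v0s] := card_gt0P k0.
have [v vs vmax] : exists2 v, v \in supp g & forall x, #|g x| <= #|g v|.
  case: (@arg_maxnP _ v0 xpredT (fun x => #|g x|) isT) => v _ vm; exists v; last by move=> x; apply: vm.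
  have := vm v0 isT; rewrite inE -card_gt0 => /(leq_trans _); apply.
  by rewrite card_gt0; move: v0s; rewrite inE.
have s0 : 0 < #|g v| by rewrite card_gt0; move: vs; rewrite inE.
have B1 := center_swap_bound gv gs ge g_min.
have B3 := packing_bound gv ge vmax b0 k0 s0.
have Zc : #|X :\: supp g| = #|X| - #|supp g|.
  by rewrite cardsD (setIidPr (valid_supp gv)).
rewrite Zc in B1.
have [hX2 hX] := half_bounds #|X|; rewrite -/h in hX hX2.
(* With few centres there is room for [h - #|supp g|] new ones and all three bounds are combined;
   with many, [B1] is enough. *)
case: (leqP (2 * #|supp g|) h) => [k_small|k_large].
  have [|J JZ Jc] := @subset_of_card _ (X :\: supp g) (h - #|supp g|).
    by rewrite Zc leq_sub2r // (leq_trans _ hX2) // leq_pmull.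
  have Jk : #|J| + #|supp g| <= h by rewrite Jc subnK.
  have B2 := lowering_bound gv ge g_min vs JZ Jk.
  have vJ : v \notin J by apply/negP => /(subsetP JZ); rewrite !inE negbK; move: vs; rewrite inE => /negbTE ->.
  rewrite cardsU1 vJ Jc in B2.
  by rewrite sixth_power; apply: (fifth_power_few_centers m2 X_large hX k_small hX2 k0 s0 B1 B2 B3).
by rewrite sixth_power; apply: (fifth_power_many_centers m2 X_large hX k_large gs hX2 B1).
Qed.
End Stars.

(** * Small transversal number *)

Lemma part_sizes n t (d := n %/ 8) : 100 * t < n -> 0 < t ->
  [/\ 2 <= d, d <= n - t.-1, d <= n - t.-1 - d, n./2 <= n - t.-1
      & t.-1 + d <= n./2./2 /\ d <= (n - t.-1 - n./2)./2].
Proof. by rewrite /d => h1 h2; do !split; lia. Qed.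

Section SmallTau.
Variable n' : nat.
Notation n := n'.+1.
Notation hyp := {set {set 'I_n}}.
Implicit Types (E : hyp) (A P X Y W e : {set 'I_n}) (s : 'S_n).

Definition preserves s A := forall x, (s x \in A) = (x \in A).

Lemma touch_preserved s A e : preserves s A -> (s @: e \in touch A) = (e \in touch A).
Proof.
move=> sA; apply/touchP/touchP => [[_ /imsetP[x xe ->]]|[x xe xA]].
  by rewrite sA; exists x.
by exists (s x); rewrite ?imset_f ?sA.
Qed.

Lemma card_imsetI_preserved s A e : preserves s A -> #|s @: e :&: A| = #|e :&: A|.
Proof.
move=> sA; rewrite -(card_perm_imset s (e :&: A)); congr #|pred_of_set _|.
apply/setP => x; rewrite -(permKV s x) !inE.
by rewrite !(mem_imset _ _ (@perm_inj _ s)) sA !inE.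
Qed.

Lemma full_stars_preserved s X Y e : preserves s X -> preserves s Y ->
  (s @: e \in full_stars Y X) = (e \in full_stars Y X).
Proof.
move=> sX sY.
have sD x : s @: e :\ s x = s @: (e :\ x).
  apply/setP => y; rewrite -(permKV s y) !inE !(mem_imset _ _ (@perm_inj _ s)) !inE.
  by rewrite (inj_eq perm_inj).
have sP (w : {set 'I_n}) : (s @: w \in pairs Y) = (w \in pairs Y).
  rewrite !inE card_perm_imset; congr (_ && _); apply/subsetP/subsetP => h x xw.
    by rewrite -sY; apply: h; rewrite imset_f.
  by move/imsetP: xw => [y yw ->]; rewrite sY; apply: h.
rewrite !inE; apply/exists_inP/exists_inP => -[x xX /andP[xe ex]].
  move/imsetP: xe xX ex => [y ye ->]; rewrite sX sD sP => yX ey.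
  by exists y; rewrite ?ye.
by exists (s x); rewrite ?sX // imset_f // sD sP.
Qed.

Lemma other_mem e x : 1 < #|e| -> exists2 y, y \in e & y != x.
Proof.
move=> e2; have /card_gt0P[y] : 0 < #|e :\ x|.
  by have := cardsD1 x e; case: (x \in e) => ec; lia.
by rewrite !inE => /andP[yx ye]; exists y.
Qed.

Lemma cards3_eq e x y z : #|e| = 3 -> x \in e -> y \in e -> z \in e ->
  x != y -> y != z -> x != z -> e = [set x; y; z].
Proof.
move=> e3 xe ye ze xy yz xz; apply/esym/eqP; rewrite eqEcard e3 cards3 // andbT.
by apply/subsetP => i; rewrite !inE => /orP[/orP[]|] /eqP ->.
Qed.

Variable F : hyp.
Hypothesis F3 : forall e, e \in F -> #|e| = 3.
Notation emb := (embeds F).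
Variables (tau : nat) (C0 : {set 'I_n}).
Hypotheses (C0_cover : F \subset touch C0) (C0_card : #|C0| = tau).
Variables (A P : {set 'I_n}).
Hypotheses (A_card : #|A|.+1 = tau) (AP : [disjoint A & P]).

Definition two_in P : hyp := [set e : {set 'I_n} | 1 < #|e :&: P|].

(** Send one cover vertex [u] to [v] and the others onto [A]. The image of an edge that misses [A]
    contains [v]; its other two vertices either include one in [P], or both lie outside [A] and
    [P]. *)
Lemma embeds_two_in_star v : v \in P -> emb ((touch A :|: two_in P) :|: full_stars (~: (A :|: P)) [set v]).
Proof.
move=> vP; have [u uC] : exists u, u \in C0 by apply/card_gt0P; rewrite C0_card -A_card.
have vA : v \notin A by rewrite (disjointFl AP).
have d0 (B : {set 'I_n}) : [disjoint B & (set0 : {set 'I_n})].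
  by rewrite disjoint_sym; apply/pred0P => x; rewrite /= inE.
have [||||s [sC su _]] := @perm_of_sets3 _ (C0 :\ u) [set u] set0 A [set v] set0 _ (d0 _) (d0 _) _ (d0 _) (d0 _) _ _ erefl.
- by rewrite disjoint_sym disjoints1 !inE eqxx.
- by rewrite disjoint_sym disjoints1.
- by have := cardsD1 u C0; rewrite uC C0_card -A_card => -[].
- by rewrite !cards1.
apply/existsP; exists s; apply/forall_inP => e eF.
have e3 : #|s @: e| = 3 by rewrite card_perm_imset F3.
rewrite !in_setU; case: (boolP (s @: e \in touch A)) => //= eA.
case: (boolP (s @: e \in two_in P)) => //= eP.
have /touchP[x xe xC] := subsetP C0_cover _ eF.
have xu : x = u.
  apply/eqP; apply: contraNT eA => xu; apply/touchP; exists (s x); first exact: imset_f.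
  by rewrite -sC imset_f // !inE xu.
have ve : v \in s @: e.
  have : s u \in [set v] by rewrite -su imset_f // inE.
  by rewrite inE => /eqP <-; rewrite imset_f // -xu.
rewrite inE; apply/exists_inP; exists v; first by rewrite inE.
rewrite ve /= inE.
move: (s @: e) e3 eA eP ve => {xe eF} {}e e3 eA eP ve.
apply/andP; split; last by have := cardsD1 v e; rewrite ve e3 add1n => -[<-].
apply/subsetP => y; rewrite !inE => /andP[yv ye]; apply/norP; split.
  by apply: contraNN eA => yA; apply/touchP; exists y.
apply: contraNN eP => yP; rewrite inE (cardsD1 v) (cardsD1 y) !inE ve vP ye yP yv.
by [].
Qed.

(** Pulling [A] and [P] back along [s] gives a small set that every edge meets once in [T'] or twice
    in [Qs]. An edge meeting the cover only in [u], with [u] outside [T'], must therefore meet this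
    set off the cover, and that part is sent into [W]. *)
Lemma embeds_two_in v W : emb (touch A :|: two_in P) -> v \notin A -> [disjoint A & W] -> v \notin W ->
  #|A| + #|P| <= #|W| ->
  emb (touch A :|: [set e : {set 'I_n} | (v \in e) && (e \in touch W)]).
Proof.
case/existsP => s /forall_inP sF vA AW vW cW.
pose T' := (s^-1)%g @: A; pose Qs := (s^-1)%g @: P.
have sT x : (x \in T') = (s x \in A).
  by rewrite -[x in LHS](permK s) (mem_imset _ _ (@perm_inj _ _)).
have sQ x : (x \in Qs) = (s x \in P).
  by rewrite -[x in LHS](permK s) (mem_imset _ _ (@perm_inj _ _)).
have [u uC uT] : exists2 u, u \in C0 & u \notin T'.
  apply/subsetPn; apply/negP => /subset_leq_card.
  by rewrite card_perm_imset C0_card -A_card ltnn.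
pose W0 := (T' :|: Qs) :\: C0.
have W0c : #|W0| <= #|W|.
  apply: leq_trans cW; apply: leq_trans (subset_leq_card (subsetDl _ _)) _.
  by apply: leq_trans (leq_card_setU _ _) _; rewrite !card_perm_imset.
have [W' W'W W'c] := subset_of_card W0c.
have [|||||||||r [rC ru rW]] := @perm_of_sets3 _ (C0 :\ u) [set u] W0 A [set v] W'.
- by rewrite disjoint_sym disjoints1 !inE eqxx.
- by rewrite disjoint_sym; apply: disjointWr (subsetDl _ _) _; rewrite disjoints_subset; apply/subsetP => x; rewrite !inE => /andP[].
- by rewrite disjoints1 !inE uC.
- by rewrite disjoint_sym disjoints1.
- exact: disjointWr W'W AW.
- by rewrite disjoints1; apply: contraNN vW; apply: (subsetP W'W).
- by have := cardsD1 u C0; rewrite uC C0_card -A_card => -[].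
- by rewrite !cards1.
- by [].
apply/existsP; exists r; apply/forall_inP => e eF.
rewrite in_setU; case: (boolP (r @: e \in touch A)) => //= eA.
have avoid x : x \in e -> x \in C0 -> x = u.
  move=> xe xC; apply/eqP; apply: contraNT eA => xu; apply/touchP; exists (r x); first exact: imset_f.
  by rewrite -rC imset_f // !inE xu.
have ue : u \in e.
  by have /touchP[x xe xC] := subsetP C0_cover _ eF; rewrite -(avoid x).
rewrite inE; apply/andP; split.
  have : r u \in [set v] by rewrite -ru imset_f // inE.
  by rewrite inE => /eqP <-; rewrite imset_f.
have [x xe xW] : exists2 x, x \in e & x \in W0.
  have := sF e eF; rewrite in_setU => /orP[/touchP[_ /imsetP[x xe ->] xA]|].
    exists x => //; rewrite !inE sT xA /= andbT; apply/negP => xC.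
    by move: uT; rewrite -(avoid x xe xC) sT xA.
  rewrite inE => /(other_mem (s u)) [_ /setIP[/imsetP[x xe ->] xP] xu].
  exists x => //; rewrite !inE sQ xP orbT andbT; apply: contraNN xu => xC.
  by rewrite (avoid x xe xC).
apply/touchP; exists (r x); rewrite ?imset_f //; apply: (subsetP W'W).
by rewrite -rW imset_f.
Qed.
End SmallTau.

(** * Choice of base hypergraphs, and the two ranges of the transversal number *)

Section QueryBound.
Variable n' : nat.
Notation n := n'.+1.
Notation hyp := {set {set 'I_n}}.
Variables (T : nat) (F : hyp).
Hypothesis F3 : forall e : {set 'I_n}, e \in F -> #|e| = 3.
Hypothesis adv : adversary_bounded T F.
Hypothesis F_neq0 : 0 < #|F|.
Notation emb := (embeds F).
Notation Q := (36 * T).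

Section Cover.
Variables (tau : nat) (C0 : {set 'I_n}).
Hypotheses (C0_cover : F \subset touch C0) (C0_card : #|C0| = tau).
Hypothesis tau_min : forall C : {set 'I_n}, F \subset touch C -> tau <= #|C|.

Lemma class_large (col : 'I_n -> nat) (S : {set 'I_n}) (y : 'I_n) (d : nat) :
  {in S, forall i, col i = col y} -> d <= #|S| -> d <= #|[set i | col i == col y]|.
Proof.
move=> sub dS; apply: leq_trans dS _; rewrite subset_leq_card //.
by apply/subsetP => i iS; rewrite inE sub.
Qed.

Lemma small_tau_bound : 100 * tau < n -> (n %/ 8) ^ 5 <= 864 * Q ^ 6.
Proof.
move=> tn; have t0 : 0 < tau := tau_gt0 F_neq0 C0_cover C0_card.
have [d2 dS dR hS [hW hX]] := part_sizes tn t0.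
set d := n %/ 8 in d2 dS dR hS hW hX *.
have [A _ Ac] : exists2 A : {set 'I_n}, A \subset [set: 'I_n] & #|A| = tau.-1.
  apply: subset_of_card; rewrite cardsT card_ord.
  by rewrite -C0_card; apply: leq_trans (leq_pred _) _; have := max_card (mem C0); rewrite card_ord.
have Atau : #|A|.+1 = tau by rewrite Ac prednK.
have AC : #|~: A| = n - tau.-1 by rewrite -(addKn #|A| #|~: A|) cardsC card_ord Ac.
have A_notemb : ~~ emb (touch A) by apply: (embeds_touch tau_min); rewrite -Atau.
have [P PA Pc] : exists2 P : {set 'I_n}, P \subset ~: A & #|P| = d.
  by apply: subset_of_card; rewrite AC.
have AP : [disjoint A & P] by rewrite disjoint_sym disjoints_subset.
have nAP x : x \in P -> x \notin A by move=> /(subsetP PA); rewrite inE.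
have [v vP] : exists v, v \in P by apply/card_gt0P; rewrite Pc; apply: ltnW.
case: (boolP (emb (touch A :|: two_in P))) => [embP|nP]; last first.
  (* Triples with two vertices in [P] are still rejected, so they join the base, and one full star
     centred in [P] makes it accepted. *)
  pose col x := if x \in A then 0 else if x \in P then 1 else 2.
  apply: (@star_bound n' T F F3 adv col P (~: (A :|: P)) (touch A :|: two_in P) d _ _ _ _ _ [set v]) => //.
  - by move=> x y xP yP; rewrite /col xP yP (negbTE (nAP x xP)) (negbTE (nAP y yP)).
  - by move=> x y xP; rewrite !inE /col xP (negbTE (nAP x xP)) => /norP[/negbTE -> /negbTE ->].
  - move=> s e sc.
    have pA : preserves s A.
      by move=> x; have := sc x; rewrite /col; case: (s x \in A); case: (x \in A) => //; case: (_ \in P).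
    have pP : preserves s P.
      move=> x; have := sc x; rewrite /col pA; case: (boolP (x \in A)) => xA.
        have sxA : s x \in A by rewrite pA.
        by rewrite (disjointFr AP xA) (disjointFr AP sxA).
      by case: (s x \in P); case: (x \in P).
    by rewrite !in_setU touch_preserved // !inE card_imsetI_preserved.
  - by rewrite Pc.
  - move=> y yAP; apply: (@class_large _ (~: (A :|: P))).
      by move: yAP => + i; rewrite !inE /col => /norP[/negbTE -> /negbTE ->] /norP[/negbTE -> /negbTE ->].
    rewrite -(addKn #|A :|: P| #|~: _|) cardsC card_ord.
    by rewrite cardsU disjoint_setI0 // cards0 subn0 Ac Pc subnDA.
  - by rewrite sub1set.
  - by rewrite cards1 Pc half_gt0.
  exact: (embeds_two_in_star F3 C0_cover C0_card Atau AP).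
have [V2 V2A V2c] : exists2 V2 : {set 'I_n}, V2 \subset ~: A & #|V2| = n./2.
  by apply: subset_of_card; rewrite AC.
pose V1 := ~: A :\: V2.
have V1c : #|V1| = n - tau.-1 - n./2 by rewrite cardsD (setIidPr V2A) AC V2c.
have [W WV Wc] : exists2 W : {set 'I_n}, W \subset V2 & #|W| = tau.-1 + d.
  by apply: subset_of_card; rewrite V2c; apply: leq_trans hW (half_le _).
(* Half of [V1] serves twice: it respects the limit on the number of centres if they are taken in
   [V1], and it leaves two large colour classes if [V1] carries the links. *)
have [X0 XV Xc] : exists2 X0 : {set 'I_n}, X0 \subset V1 & #|X0| = #|V1|./2.
  by apply: subset_of_card; apply: half_le.
have Xd : d <= #|X0| by rewrite Xc V1c.
have [u uX] : exists u, u \in X0 by apply/card_gt0P; apply: leq_trans Xd; apply: ltnW.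
have inV1 x : (x \in V1) = (x \notin V2) && (x \notin A) by rewrite !inE.
have V2nA x : x \in V2 -> (x \in A) = false by move=> /(subsetP V2A); rewrite inE => /negbTE.
have /andP[uV2 uA] : (u \notin V2) && (u \notin A) by rewrite -inV1 (subsetP XV).
have uW : u \notin W by apply: contraNN uV2; apply: (subsetP WV).
have d_V2 : d <= #|V2|.
  by rewrite V2c; apply: leq_trans (leq_addl tau.-1 d) _; apply: leq_trans hW (half_le _).
have embW : emb (touch A :|: [set e : {set 'I_n} | (u \in e) && (e \in touch W)]).
  apply: (embeds_two_in C0_cover C0_card Atau embP) => //; last by rewrite Ac Pc Wc.
  by rewrite disjoint_sym disjoints_subset (subset_trans WV).
case: (boolP (emb (touch A :|: full_stars V2 X0))) => [emb2|nemb2].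
  pose col x := if x \in A then 0 else if x \in V2 then 2 else 1.
  apply: (@star_bound n' T F F3 adv col V1 V2 (touch A) d _ _ _ _ _ X0) => //.
  - move=> x y; rewrite !inV1 /col => /andP[/negbTE -> /negbTE ->].
    by move=> /andP[/negbTE -> /negbTE ->].
  - move=> x y; rewrite inV1 /col => /andP[/negbTE -> /negbTE ->] yV2.
    by rewrite V2nA // yV2.
  - move=> s e sc; apply: touch_preserved => x.
    by have := sc x; rewrite /col; case: (s x \in A); case: (x \in A) => //; case: (_ \in V2).
  - by apply: leq_trans Xd _; apply: subset_leq_card.
  - by move=> y yV2; apply: (@class_large _ V2) => // i iV2; rewrite /col !V2nA // iV2 yV2.
  by rewrite Xc.
(* The roles are exchanged: the stars centred in [X0] with links on [V2] join the base, and the new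
   centres are the vertices of [W] with links on [V1]. *)
pose col x := if x \in A then 0 else if x \in V2 then 3 else if x \in X0 then 1 else 2.
have X0V x : x \in X0 -> (x \in A = false) * (x \in V2 = false).
  by move=> /(subsetP XV); rewrite inV1 => /andP[/negbTE -> /negbTE ->].
apply: (@star_bound n' T F F3 adv col V2 V1 (touch A :|: full_stars V2 X0) d _ _ _ _ _ W) => //.
- by move=> x y xV yV; rewrite /col !V2nA // xV yV.
- move=> x y xV; rewrite inV1 /col (V2nA x xV) xV => /andP[/negbTE -> /negbTE ->].
  by case: ifP.
- move=> s e sc.
  have pA : preserves s A.
    move=> x; have := sc x; rewrite /col.
    by case: (s x \in A); case: (x \in A) => //; case: (_ \in V2) => //; case: (_ \in X0).
  have pV : preserves s V2.
    move=> x; have := sc x; rewrite /col pA; case: (boolP (x \in A)) => xA.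
      have sxA : s x \in A by rewrite pA.
      by move=> _; apply/idP/idP => /V2nA; rewrite ?xA ?sxA.
    by case: (s x \in V2); case: (x \in V2) => //; case: (_ \in X0).
  have pX : preserves s X0.
    move=> x; have := sc x; rewrite /col pA pV; case: (boolP (x \in A)) => xA.
      have sxA : s x \in A by rewrite pA.
      by move=> _; apply/idP/idP => /X0V[]; rewrite ?xA ?sxA.
    case: (boolP (x \in V2)) => xV.
      have sxV : s x \in V2 by rewrite pV.
      by move=> _; apply/idP/idP => /X0V[_]; rewrite ?xV ?sxV.
    by case: (s x \in X0); case: (x \in X0).
  by rewrite !in_setU touch_preserved // full_stars_preserved.
- move=> y; rewrite inV1 => /andP[yV yA]; case: (boolP (y \in X0)) => yX.
    by apply: (@class_large _ X0) => // i iX; rewrite /col !X0V // iX yX.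
  apply: (@class_large _ (V1 :\: X0)).
    move=> i; rewrite inE inV1 /col (negbTE yV) (negbTE yA) (negbTE yX).
    by move=> /andP[/negbTE -> /andP[/negbTE -> /negbTE ->]].
  rewrite cardsD (setIidPr XV) Xc -V1c in hX *; apply: leq_trans hX _.
  by have [h1 h2] := half_bounds #|V1|; rewrite leq_subRL ?half_le // addnn -mul2n.
- by rewrite Wc V2c.
apply: (embeds_mono F3 _ embW) => e e3; rewrite !in_setU.
case: (boolP (e \in touch A)) => //= eA; rewrite inE => /andP[ue /touchP[w we wW]].
have wV := subsetP WV _ wW.
have uw : u != w by apply: contraNneq uV2 => ->.
(* The edge contains [u] in [X0] and [w] in [W]. If its third vertex is in [V2] it belongs to the
   star of [u] in the base, otherwise to the new star of [w]. *)
case: (boolP (e :\ u \subset V2)) => [eV|/subsetPn[z]].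
  apply/orP; left; rewrite inE; apply/exists_inP; exists u => //; rewrite ue /= inE eV /=.
  by have := cardsD1 u e; rewrite ue e3 add1n => -[<-].
rewrite !inE => /andP[zu ze] zV; apply/orP; right; apply/exists_inP; exists w => //.
have zw : z != w by apply: contraNneq zV => ->.
have zA : z \notin A by apply: contraNN eA => zA; apply/touchP; exists z.
rewrite we /= inE; apply/andP; split; last first.
  by have := cardsD1 w e; rewrite we e3 add1n => -[<-].
rewrite (cards3_eq e3 ue we ze uw) 1?eq_sym //.
apply/subsetP => i; rewrite inE => /andP[iw]; rewrite inV1 !inE.
by rewrite in_set1 in iw; rewrite (negbTE iw) orbF => /orP[]/eqP ->; rewrite ?uV2 ?zV.
Qed.
End Cover.

Lemma query_bound : 2 <= n' ->
  n ^ 5 <= 1800 * (1800 * 1800) * Q ^ 6 \/ n ^ 5 <= 16 ^ 5 * (864 * Q ^ 6).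
Proof.
move=> n2.
have T0 : F \subset touch [set: 'I_n].
  apply/subsetP => e eF; have /card_gt0P[x xe] : 0 < #|e| by rewrite F3.
  by apply/touchP; exists x.
case: (@arg_minnP _ setT (fun C => F \subset touch C) (fun C : {set 'I_n} => #|C|) T0) => C0 cover min.
case: (leqP n (100 * #|C0|)) => h.
  by left; apply: (large_tau_bound F3 adv F_neq0 cover erefl min n2 h).
right; apply: leq_trans (leq_mul (leqnn _) (small_tau_bound cover erefl min h)).
(* It remains that [n] is at most 16 times [n %/ 8], which holds because the quotient is
   positive. *)
rewrite -expnMn leq_exp2r //.
have [d2 _ _ _ _] := part_sizes h (tau_gt0 F_neq0 cover erefl).
by move: n d2 => N; clear; lia.
Qed.
End QueryBound.

(** The constant is the cube of 1800, the larger of the two in [query_bound]. *)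
Lemma query_bound_real n H m T U out : Peano.le 3 n ->
  (exists a b d, [/\ Peano.lt a b, Peano.lt b d, Peano.lt d n & H a b d = true]) ->
  computes_fH n H m T U out ->
  (INR n ^ 5 <= 5832000000 * (36 * INR T) ^ 6)%R.
Proof.
move=> /leP; case: n => // n' n2 [a [b [c [/ltP ab /ltP bc /ltP cn h]]]] alg.
have bn := ltn_trans bc cn; have an := ltn_trans ab bn.
have F0 : 0 < #|edges n' H|.
  apply/card_gt0P; exists [set inord a; inord b; inord c]; apply/edgesP.
  by exists (inord a), (inord b), (inord c); split; rewrite ?inordK.
have INR36 : INR 36 = 36%R by rewrite INR_IZR_INZ.
have powE x k : INR (x ^ k) = (INR x ^ k)%R.
  by elim: k => [|k IH] //=; rewrite expnS -multE mult_INR IH.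
have mulE x y : INR (x * y) = (INR x * INR y)%R by rewrite -multE mult_INR.
have Q0 : (0 <= (36 * INR T) ^ 6)%R by apply: pow_le; have := pos_INR T; lra.
have toR x y : x <= y -> (INR x <= INR y)%R by move=> xy; apply: le_INR; apply/leP.
case: (query_bound (@edges_card3 n' H) (computes_adversary_bounded alg) F0 n2) => /toR.
  rewrite (powE n'.+1 5) (mulE (1800 * (1800 * 1800))) (powE (36 * T) 6) (mulE 36 T).
  rewrite (mulE 1800) (mulE 1800 1800) INR36.
  have -> : INR 1800 = 1800%R by rewrite INR_IZR_INZ.
  lra.
rewrite (powE n'.+1 5) (mulE (16 ^ 5)) (mulE 864) (powE 16 5) (powE (36 * T) 6) (mulE 36 T).
rewrite INR36.
have -> : INR 864 = 864%R by rewrite INR_IZR_INZ.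
have -> : INR 16 = 16%R by rewrite INR_IZR_INZ.
lra.
Qed.
End QueryBounds.

Theorem theorem4 :
  exists c : R, c > 0 /\
    forall (n : nat), (3 <= n)%nat ->
    forall H : hgraph,
      (exists a b d, (a < b)%nat /\ (b < d)%nat /\ (d < n)%nat /\ H a b d = true) ->
      forall (m T : nat) (U : nat -> nat -> nat -> Cx) (out : nat -> bool),
        computes_fH n H m T U out ->
        INR T >= c * Rpower (INR n) (4 / 5).
Proof.
(* 1800 = 36 * 50: a smaller [T] would give [36 * INR T < x / 50], and the sixth power of 50 exceeds
   5832000000. *)
exists (1 / 1800); split; [lra|].
intros n n3 H [a [b [d [ab [bd [dn h]]]]]] m T U out alg.
assert (main : INR n ^ 5 <= 5832000000 * (36 * INR T) ^ 6).
{ refine (QueryBounds.query_bound_real n3 _ alg).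
  exists a, b, d; split; assumption. }
assert (n1 : 1 < INR n) by (apply lt_1_INR; lia).
set (x := Rpower (INR n) (4 / 5)).
assert (x0 : 0 < x) by (unfold x, Rpower; apply exp_pos).
(* The exponent on the left is 24/5; the bound on [n ^ 5] would even allow the exponent 5/6 in place
   of 4/5. *)
assert (x6 : x ^ 6 <= INR n ^ 5).
{ rewrite <- (Rpower_pow 6 x) by exact x0; rewrite <- (Rpower_pow 5) by lra.
  unfold x; rewrite Rpower_mult; apply Rle_Rpower; [lra|].
  rewrite !INR_IZR_INZ; simpl; lra. }
apply Rnot_lt_ge; intro small.
assert (T0 := pos_INR T).
assert (le : (36 * INR T) ^ 6 <= (x / 50) ^ 6) by (apply pow_incr; lra).
assert (e : (x / 50) ^ 6 = x ^ 6 / 15625000000) by field.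
rewrite e in le.
assert (0 < x ^ 6) by (apply pow_lt; exact x0).
lra.
Qed.
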